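(* Let $m>k$ be positive integers, $\delta>0$, and let $x\in\mathbb{R}^k$ be fixed. Let $E=(e_{ij})\in\mathbb{R}^{m\times k}$ be a random matrix with isotropic sub-Gaussian rows. Furthermore, assume that the entries of $E$ are i.i.d. with a density function $\phi$ that is a Schwartz function. Then the $i$th entry of $\mathbb{E}E^T(Ex-Q(Ex))$ satisfies $$\left(\mathbb{E}E^T(Ex-Q(Ex))\right)_i=m\left(x_i+x_i\sum_{p\in\mathbb{Z}}\left((-1)^p\,\widehat g\Big(\frac{|x_i|}{\delta}p\Big)\prod_{s\ne i}\widehat\phi\Big(\frac{x_s\,\mathrm{sign}(x_i)}{\delta}p\Big)\right)\right),$$ where $g(z):=\mathbb{E}\,e_{11}\mathbf{1}_{\{e_{11}\le z\}}=\int_{-\infty}^z t\phi(t)\,dt$. In particular, if $E$ is a Gaussian matrix (its entries are i.i.d. standard Gaussian), then $$\left(\mathbb{E}E^T(Ex-Q(Ex))\right)_i=-2mx_i\sum_{p=1}^\infty(-1)^p\exp\Big(-\frac{2\pi^2\|x\|^2p^2}{\delta^2}\Big),$$ which implies $$2\|x\|\left(\exp\Big(-\frac{2\pi^2\|x\|^2}{\delta^2}\Big)-\exp\Big(-\frac{8\pi^2\|x\|^2}{\delta^2}\Big)\right)<\mu<2\|x\|\exp\Big(-\frac{2\pi^2\|x\|^2}{\delta^2}\Big),$$ where $\mu=\frac1m\|\mathbb{E}E^T(Ex-Q(Ex))\|$.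
   Context: $\|\cdot\|$ is the Euclidean norm. For $\delta>0$, the uniform scalar quantizer $q_\delta:\mathbb{R}\to\delta\mathbb{Z}$ is $q_\delta(t)=n\delta$ if $t\in(n\delta-\delta/2,\,n\delta+\delta/2]$, $n\in\mathbb{Z}$; $Q=Q_\delta^{\rm MSQ}:\mathbb{R}^m\to(\delta\mathbb{Z})^m$ applies $q_\delta$ to each coordinate. The Fourier transform is $\widehat f(\omega)=\int_{\mathbb{R}}e^{-2\pi i t\omega}f(t)\,dt$ (here, in the exponent, $i$ is the imaginary unit). A real random variable $z$ is sub-Gaussian if $\|z\|_{\psi_2}=\sup_{p\ge1}p^{-1/2}(\mathbb{E}|z|^p)^{1/p}<\infty$. A random vector $Y\in\mathbb{R}^n$ is sub-Gaussian if $\langle Y,z\rangle$ is sub-Gaussian for all $z\in\mathbb{R}^n$, and isotropic if $\mathbb{E}\langle Y,z\rangle^2=\|z\|^2$ for all $z\in\mathbb{R}^n$.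
   Formalization: For k=1 the entries are also assumed to have mean zero (otherwise g is not integrable and its Fourier transform at 0 is undefined); the strict bounds on μ are stated only for x≠0, since at x=0 all three members equal 0. *)

(* Defs.v *)
From HB Require Import structures.
From mathcomp Require Export all_boot all_order all_algebra.
From mathcomp Require Import lra.
From mathcomp Require Export complex.
From mathcomp Require Export all_classical all_reals all_analysis.

Set Implicit Arguments.
Unset Strict Implicit.
Unset Printing Implicit Defensive.

Export Order.TTheory GRing.Theory Num.Theory.
Export numFieldNormedType.Exports.

Local Open Scope classical_set_scope.
Local Open Scope ring_scope.

Section vectors.
Context {R : realType}.

Definition dotv n (u v : 'cV[R]_n) : R := \sum_i u i 0 * v i 0.

(* The library norm on matrices is the sup norm, hence this definition. *)
Definition enorm n (u : 'cV[R]_n) : R := Num.sqrt (\sum_i u i 0 ^+ 2).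

(* See quantP for the defining property. *)
Definition quant (delta t : R) : R :=
  delta * (Num.ceil (t / delta - 2^-1))%:~R.

Definition msq n (delta : R) (y : 'cV[R]_n) : 'cV[R]_n :=
  map_mx (quant delta) y.

Definition residual m k (delta : R) (x : 'cV[R]_k) (E : 'M[R]_(m, k)) :
    'cV[R]_k :=
  E^T *m (E *m x - msq delta (E *m x)).

Lemma quantP (delta t : R) (n : int) : 0 < delta ->
  quant delta t = n%:~R * delta <->
  n%:~R * delta - delta / 2 < t <= n%:~R * delta + delta / 2.
Proof.
move=> d0; have dN0 : delta != 0 by rewrite gt_eqF.
have -> : (n%:~R * delta - delta / 2 < t <= n%:~R * delta + delta / 2) =
          (Num.ceil (t / delta - 2^-1) == n).
  rewrite ceil_eq intrB ltrBrDr lerBlDr ltr_pdivlMr// ler_pdivrMr//.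
  congr (_ && _); last by rewrite mulrDl [_^-1 * _]mulrC.
  by congr (_ < _); lra.
rewrite /quant mulrC; split=> [/(mulIf dN0)/intr_inj/eqP//|/eqP -> //].
Qed.

End vectors.

Section complex_analysis.
Context {R : realType}.
Local Open Scope complex_scope.

Definition expi (theta : R) : R[i] := cos theta +i* sin theta.

Definition Cintegral (f : R -> R[i]) : R[i] :=
  (\int[@lebesgue_measure R]_t complex.Re (f t)) +i*
  (\int[@lebesgue_measure R]_t complex.Im (f t)).

Definition fourier (f : R -> R) (omega : R) : R[i] :=
  Cintegral (fun t => expi (- (2 * pi * t * omega)) * (f t)%:C).

(* Limit of the partial sums over -N <= p <= N; it is the sum over the integers
   whenever the family is absolutely summable. *)
Definition sumZ (F : int -> R[i]) : R[i] :=
  limn (fun N : nat =>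
    (\sum_(j < N.*2.+1) F (j%:Z - N%:Z) : R[i]^o)).

Definition Csummable (F : int -> R[i]) : Prop :=
  summable [set: int] (fun p => (Normc.normc (F p))%:E).

Definition schwartz (f : R -> R) : Prop :=
  (forall n t, derivable (derive1n n f) t 1) /\
  (forall a b : nat, exists M : R,
    forall t, `|t ^+ a * derive1n b f t| <= M).

End complex_analysis.

Section probability.
Context {R : realType} {d : measure_display} {T : measurableType d}.
Variable P : probability T R.

Definition psi2_norm (z : T -> R) : \bar R :=
  ereal_sup [set ((p `^ (- 2^-1))%:E * 'N[P]_p%:E[EFin \o z])%E
            | p in [set p : R | 1 <= p]].

Definition subgaussian (z : T -> R) : Prop := (psi2_norm z < +oo)%E.

Definition subgaussian_vec n (Y : T -> 'cV[R]_n) : Prop :=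
  forall z : 'cV[R]_n, subgaussian (fun t => dotv (Y t) z).

Definition isotropic n (Y : T -> 'cV[R]_n) : Prop :=
  forall z : 'cV[R]_n,
    ('E_P[(fun t => dotv (Y t) z ^+ 2)%R] = (enorm z ^+ 2)%:E)%E.

Definition mutually_independent (I : finType) (X : I -> {RV P >-> R}) : Prop :=
  forall (J : {set I}) (B : I -> set R), (forall i, measurable (B i)) ->
    P (\bigcap_(i in [set` J]) (X i @^-1` B i)) =
    (\prod_(i in J) P (X i @^-1` B i))%E.

Definition has_density (X : {RV P >-> R}) (phi : R -> R) : Prop :=
  [/\ measurable_fun setT phi, forall t, 0 <= phi t &
      forall A : set R, measurable A ->
        distribution P X A = (\int[lebesgue_measure]_(t in A) (phi t)%:E)%E].

Definition standard_gaussian (X : {RV P >-> R}) : Prop :=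
  forall A : set R, measurable A -> distribution P X A = normal_prob 0 1 A.

Definition random_matrix m k (e : 'I_m -> 'I_k -> {RV P >-> R}) (t : T) :
    'M[R]_(m, k) :=
  \matrix_(i, j) e i j t.

Definition integrable_vec n (Y : T -> 'cV[R]_n) : Prop :=
  forall i, P.-integrable setT (EFin \o (fun t => Y t i 0)).

Definition expectation_vec n (Y : T -> 'cV[R]_n) : 'cV[R]_n :=
  \col_i fine ('E_P[fun t => (Y t i 0)%R])%E.

Definition truncated_mean (X : {RV P >-> R}) (z : R) : R :=
  fine ('E_P[fun t => (X t * \1_[set s | X s <= z] t)%R])%E.

End probability.

(* Main.v *)
(** The quantization error h(y) = y - q(y) is delta-periodic.  Its Fourier
    series does not converge uniformly, so it is replaced by its Abel means
    (delta / pi) arg(1 + r e^(2 pi i y / delta)), which are bounded and converge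
    pointwise to h as r tends to 1, up to the jump points; those contribute
    nothing because the indicator of the jump set is a bounded limit of Cesaro
    means of cosines.  Dominated convergence thus turns E[X h(Y)] into a series
    in the coefficients E[X e^(-2 pi i n Y / delta)].  For X an entry of E and
    Y = <row, x>, independence factors each coefficient into one-dimensional
    Fourier integrals.  Integration by parts (g' = t phi) rewrites the factor
    E[X e^(-ibX)] as i b times the Fourier transform of g; the p = 0 term of the
    resulting bilateral series is the integral of g, which is -E[X^2] = -1, and
    it cancels the summand x_i.  In the Gaussian case the factors are explicit,
    and the bounds on mu are those of an alternating series with strictly
    decreasing terms. *)

Require Import Defs.
From mathcomp Require Import finmap zify ring lra measurable_realfun.

Set Implicit Arguments.
Unset Strict Implicit.
Unset Printing Implicit Defensive.

Local Open Scope classical_set_scope.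
Local Open Scope ring_scope.

(** Exchanging sum and expectation takes two limits in a fixed order. For fixed [r < 1] the Abel
    series converges uniformly in the angle; afterwards [r] tends to 1 at a fixed truncation index,
    under a tail bound that does not depend on [r]. That bound rests on sine coefficients which,
    divided by [n], are at most [C / n^2]. For a Schwartz density the decay comes from two
    integrations by parts, because [t phi(t)] has an integrable derivative.

    Centering is the delicate point: at +oo the function [g] tends to the mean of an entry, so it is
    integrable only if that mean is 0. Isotropy makes two entries of a row uncorrelated, and
    independence turns this into the vanishing of the square of their common mean.

    Independence is given on events only. A transfer principle carries identities from indicators to
    integrable functions; its weights let one statement serve both densities and independent
    factors.

    If [x_i = 0] the series may diverge and the limit operators then return an unspecified value,
    which is always multiplied by [x_i]. *)

Notation rint mu f := (mu.-integrable [set: _] (EFin \o f)).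

(** * Real-valued integrals: closure properties and dominated convergence *)

Section real_integrals.
Context d (T : measurableType d) (R : realType).
Variable mu : {measure set T -> \bar R}.
Implicit Types f g : T -> R.

Lemma rint_measurable f : rint mu f -> measurable_fun setT f.
Proof. by move=> /integrableP[/measurable_EFinP]. Qed.

Lemma rintD f g : rint mu f -> rint mu g -> rint mu (fun x => f x + g x).
Proof.
move=> hf hg.
rewrite (_ : EFin \o _ = (EFin \o f) \+ (EFin \o g))%E; last exact/funext.
exact: integrableD.
Qed.

Lemma rintZ (a : R) f : rint mu f -> rint mu (fun x => a * f x).
Proof.
move=> hf; rewrite (_ : EFin \o _ = (fun x => a%:E * (EFin \o f) x)%E)//.
exact: integrableZl.
Qed.

Lemma rintB f g : rint mu f -> rint mu g -> rint mu (fun x => f x - g x).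
Proof.
move=> hf hg; rewrite (_ : EFin \o _ = EFin \o (fun x => f x + -1 * g x)).
  by apply: rintD => //; exact: rintZ.
by apply/funext => x /=; rewrite mulN1r.
Qed.

Lemma rint_le f g : measurable_fun setT f -> (forall x, `|f x| <= g x) ->
  rint mu g -> rint mu f.
Proof.
move=> mf fg; apply: le_integrable => //; first exact/measurable_EFinP.
by move=> x _ /=; rewrite lee_fin (le_trans (fg x))// ler_norm.
Qed.

Lemma rint_sum (I : Type) (s : seq I) (F : I -> T -> R) :
  (forall i, rint mu (F i)) -> rint mu (fun x => \sum_(i <- s) F i x).
Proof.
move=> hF; elim: s => [|i s IH].
  rewrite (_ : EFin \o _ = cst 0%E); first exact: integrable0.
  by apply/funext => x /=; rewrite big_nil.
rewrite (_ : EFin \o _ = EFin \o (fun x => F i x + \sum_(j <- s) F j x)).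
  exact: rintD.
by apply/funext => x /=; rewrite big_cons.
Qed.

Lemma Rintegral_sum (I : Type) (s : seq I) (F : I -> T -> R) :
  (forall i, rint mu (F i)) ->
  \int[mu]_x (\sum_(i <- s) F i x) = \sum_(i <- s) \int[mu]_x F i x.
Proof.
move=> hF; elim: s => [|i s IH].
  rewrite big_nil (_ : (fun _ => _) = cst 0) ?Rintegral_cst ?mul0r//.
  by apply/funext => x /=; rewrite big_nil.
rewrite big_cons -IH -RintegralD//; last exact: rint_sum.
by apply: eq_Rintegral => x _; rewrite big_cons.
Qed.

Lemma Rintegral_dominated (f_ : nat -> T -> R) f g :
  (forall n, measurable_fun setT (f_ n)) -> measurable_fun setT f ->
  (forall x, f_ n x @[n --> \oo] --> f x) ->
  rint mu g -> (forall n x, `|f_ n x| <= g x) ->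
  \int[mu]_x f_ n x @[n --> \oo] --> \int[mu]_x f x.
Proof.
move=> mf_ mf cf ig fg.
have [||||_ _ h] := @dominated_convergence d T R mu setT measurableT
    (fun n => EFin \o f_ n) (EFin \o f) (EFin \o g) _ _ _ ig.
- by move=> n; exact/measurable_EFinP.
- exact/measurable_EFinP.
- by apply: aeW => x _ /=; apply: cvg_EFin; [exact: nearW|exact: cf].
- by apply: aeW => x n _ /=; rewrite lee_fin.
have if_ n : rint mu (f_ n) by exact: rint_le ig.
have if0 : rint mu f.
  apply: (rint_le mf _ ig) => x.
  have /cvg_norm/cvgr_to_le := cf x; apply.
  by apply: nearW => n; exact: fg.
apply: (@fine_cvg _ _ _ _ (fun n => \int[mu]_x (f_ n x)%:E)%E).
by rewrite /Rintegral fineK//; exact: integrable_fin_num.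
Qed.

End real_integrals.

(** * Transfer of integral identities from indicators to functions *)

Section transfer.
Context d1 d2 (T1 : measurableType d1) (T2 : measurableType d2) (R : realType).
Variables (m1 : {measure set T1 -> \bar R}) (m2 : {measure set T2 -> \bar R}).
Variables (X1 : T1 -> R) (X2 : T2 -> R).
Hypotheses (mX1 : measurable_fun setT X1) (mX2 : measurable_fun setT X2).
Variables (w1 : T1 -> R) (w2 : T2 -> R).
Hypotheses (mw1 : measurable_fun setT w1) (mw2 : measurable_fun setT w2).
Hypotheses (w1_ge0 : forall x, 0 <= w1 x) (w2_ge0 : forall x, 0 <= w2 x).
Hypothesis indic_eq : forall A : set R, measurable A ->
  (\int[m1]_x (\1_A (X1 x) * w1 x)%:E = \int[m2]_x (\1_A (X2 x) * w2 x)%:E)%E.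

Import HBNNSimple.

Let nnsfun_eq (h : {nnsfun R >-> R}) :
  (\int[m1]_x (h (X1 x) * w1 x)%:E = \int[m2]_x (h (X2 x) * w2 x)%:E)%E.
Proof.
have key d (T : measurableType d) (m : {measure set T -> \bar R}) (X w : T -> R) :
    measurable_fun setT X -> measurable_fun setT w -> (forall x, 0 <= w x) ->
  (\int[m]_x (h (X x) * w x)%:E = \sum_(i < #|` fset_set (range h)|%fset)
    ((fset_set (range h))`_i)%:E *
      \int[m]_x (\1_(h @^-1` [set (fset_set (range h))`_i]) (X x) * w x)%:E)%E.
  move=> mX mw w0; set s := fset_set (range h).
  have s0 (i : 'I_#|` s|) : 0 <= s`_i.
    have : s`_i \in s by exact: mem_nth.
    by rewrite in_fset_set// => /set_mem[y _ <-].
  under eq_integral => x _.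
    rewrite (fimfunEord h (X x)) mulr_suml -sumEFin.
    under eq_bigr do rewrite -mulrA EFinM.
    over.
  have mi (i : 'I_#|` s|) : measurable_fun setT
      (fun x => (\1_(h @^-1` [set s`_i]) (X x) * w x)%:E).
    apply/measurable_EFinP/measurable_funM => //.
    exact/(measurableT_comp _ mX)/measurable_indic.
  rewrite ge0_integral_sum//.
  - apply: eq_bigr => i _; rewrite ge0_integralZl_EFin// => x _.
    by rewrite lee_fin mulr_ge0.
  - by move=> i; exact: measurable_funeM.
  - by move=> i x _; rewrite mule_ge0// lee_fin ?mulr_ge0.
rewrite (key _ _ m1)// (key _ _ m2)//; apply: eq_bigr => i _.
by rewrite indic_eq.
Qed.

(** Both sides commute with increasing limits in [f], and [f] is such a limit of simple functions,
    for which the identity follows from the one on indicators. With [w1 = 1] and [w2] a density this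
    is the passage to Lebesgue measure; with [w2] constant it expresses independence of [X1] and
    [w1]. *)
Lemma transfer_ge0 (f : R -> R) : measurable_fun setT f -> (forall y, 0 <= f y) ->
  (\int[m1]_x (f (X1 x) * w1 x)%:E = \int[m2]_x (f (X2 x) * w2 x)%:E)%E.
Proof.
move=> mf f0.
have mf' : measurable_fun setT (EFin \o f) by exact/measurable_EFinP.
pose h := nnsfun_approx measurableT mf'.
have key d (T : measurableType d) (m : {measure set T -> \bar R}) (X w : T -> R) :
    measurable_fun setT X -> measurable_fun setT w -> (forall x, 0 <= w x) ->
  (\int[m]_x (h n (X x) * w x)%:E @[n --> \oo] --> \int[m]_x (f (X x) * w x)%:E)%E.
  move=> mX mw w0.
  have c x : (h n (X x) * w x)%:E @[n --> \oo] --> (f (X x) * w x)%:E.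
    under eq_fun do rewrite EFinM.
    rewrite EFinM; apply: cvgeZr => //.
    by apply: (@cvg_nnsfun_approx _ _ _ _ measurableT _ mf') => // y _; rewrite lee_fin.
  under [X in _ --> X]eq_integral do rewrite -(cvg_lim _ (c _))//.
  apply: cvg_monotone_convergence => //.
  - move=> n; apply/measurable_EFinP/measurable_funM => //.
    exact: measurableT_comp.
  - by move=> n x _; rewrite lee_fin mulr_ge0.
  - move=> x _ a b ab; rewrite lee_fin ler_wpM2r//.
    by have /lefP := nd_nnsfun_approx measurableT mf' ab; exact.
have k1 := key _ _ m1 _ _ mX1 mw1 w1_ge0.
have k2 := key _ _ m2 _ _ mX2 mw2 w2_ge0.
rewrite (_ : (fun n => _) = (fun n => \int[m2]_x (h n (X2 x) * w2 x)%:E)%E) in k1; last by apply/funext => n; exact: nnsfun_eq.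
by move: k1 => /cvg_lim <-//; move: k2 => /cvg_lim <-.
Qed.

Lemma transfer (f : R -> R) : measurable_fun setT f ->
  rint m2 (fun x => f (X2 x) * w2 x) ->
  rint m1 (fun x => f (X1 x) * w1 x) /\
  \int[m1]_x (f (X1 x) * w1 x) = \int[m2]_x (f (X2 x) * w2 x).
Proof.
move=> mf i2.
have m1f : measurable_fun setT (fun x => f (X1 x) * w1 x).
  by apply: measurable_funM => //; exact: measurableT_comp.
have mn : measurable_fun setT (fun y => `|f y|) by exact: measurableT_comp.
have i1 : rint m1 (fun x => f (X1 x) * w1 x).
  apply/integrableP; split; first exact/measurable_EFinP.
  move/integrableP : i2 => [_]; congr (_ < _)%E.
  under eq_integral => x _ do rewrite /= normrM (ger0_norm (w2_ge0 x)).
  under [RHS]eq_integral => x _ do rewrite /= normrM (ger0_norm (w1_ge0 x)).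
  by rewrite (transfer_ge0 mn).
split => //.
(* [f] is the difference of the nonnegative [p] and [q], both integrable along with [f], so the
   nonnegative case applies to each. *)
pose p y := (f y + `|f y|); pose q y := `|f y|.
have mp : measurable_fun setT p by exact: measurable_funD.
have p0 y : 0 <= p y by have := ler_norm (- f y); rewrite /p normrN; lra.
have rq d (T : measurableType d) (m : {measure set T -> \bar R}) (X w : T -> R) :
    (forall x, 0 <= w x) -> measurable_fun setT X -> measurable_fun setT w ->
    rint m (fun x => f (X x) * w x) ->
    \int[m]_x (f (X x) * w x) =
    \int[m]_x (p (X x) * w x) - \int[m]_x (q (X x) * w x).
  move=> w0 mX mw ii.
  have iq : rint m (fun x => q (X x) * w x).
    apply: (rint_le _ _ (g := fun x => `|f (X x) * w x|)).
    - apply: measurable_funM => //; exact: measurableT_comp.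
    - by move=> x; rewrite !normrM normr_id.
    - exact: (integrable_norm ii).
  rewrite -RintegralB//.
    by apply: eq_Rintegral => x _; rewrite /p /q; ring.
  rewrite (_ : EFin \o _ = EFin \o (fun x => f (X x) * w x + q (X x) * w x)).
    exact: rintD.
  by apply/funext => x /=; rewrite /p /q mulrDl.
rewrite (rq _ _ m1)// (rq _ _ m2)//.
by rewrite /Rintegral (transfer_ge0 mp p0) (transfer_ge0 mn).
Qed.

End transfer.

(** * Complex-valued integrals and the modulus *)

Section complex_integral.
Context d (T : measurableType d) (R : realType).
Variable mu : {measure set T -> \bar R}.
Implicit Types f g : T -> R[i].

Definition Cint f : R[i] :=
  Complex (\int[mu]_x complex.Re (f x)) (\int[mu]_x complex.Im (f x)).

Definition cintegrable f : Prop :=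
  rint mu (fun x => complex.Re (f x)) /\ rint mu (fun x => complex.Im (f x)).

Definition cmeasurable f : Prop :=
  measurable_fun setT (fun x => complex.Re (f x)) /\
  measurable_fun setT (fun x => complex.Im (f x)).

End complex_integral.

Section complex_facts.
Context {R : rcfType}.
Implicit Types z w : R[i].

Lemma ReM z w : complex.Re (z * w) =
  complex.Re z * complex.Re w - complex.Im z * complex.Im w.
Proof. by case: z w => [a b] [a' b']. Qed.

Lemma ImM z w : complex.Im (z * w) =
  complex.Re z * complex.Im w + complex.Im z * complex.Re w.
Proof. by case: z w => [a b] [a' b'] /=; rewrite addrC. Qed.

Lemma ge_Re_normc z : `|complex.Re z| <= Normc.normc z.
Proof.
case: z => a b /=; rewrite -sqrtr_sqr ler_wsqrtr// lerDl; exact: sqr_ge0.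
Qed.

Lemma ge_Im_normc z : `|complex.Im z| <= Normc.normc z.
Proof.
case: z => a b /=; rewrite -sqrtr_sqr ler_wsqrtr// lerDr; exact: sqr_ge0.
Qed.

Lemma normcM z w : Normc.normc (z * w) = Normc.normc z * Normc.normc w.
Proof. exact: Normc.normcM. Qed.

Lemma normc_ge0 z : 0 <= Normc.normc z.
Proof. by case: z => a b; exact: sqrtr_ge0. Qed.

Lemma normc_real (a : R) : Normc.normc (Complex a 0) = `|a|.
Proof. by rewrite /= expr0n addr0 sqrtr_sqr. Qed.

End complex_facts.

(** * Product formula for expectations of independent variables *)

Section independence.
Context d (T : measurableType d) (R : realType) (P : probability T R).

Let prob_fin (A : set T) : measurable A -> P A \is a fin_num.
Proof. by move=> mA; exact: fin_num_measure. Qed.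

Lemma rint_bounded (f : T -> R) (B : R) :
  measurable_fun setT f -> (forall t, `|f t| <= B) -> rint P f.
Proof.
move=> mf fB; apply: (rint_le mf fB (g := cst B)).
exact: finite_measure_integrable_cst.
Qed.

Lemma Rintegral_prob_cst (a : R) : \int[P]_x a = a.
Proof. 
rewrite Rintegral_cst// -[RHS]mulr1; congr (_ * _).
by transitivity (fine 1%E : R) => //; congr fine; exact: probability_setT. Qed.

Let indic1 (A : set R) (y : R) : `|\1_A y : R| <= 1.
Proof. by rewrite ger0_norm// indicE lern1 leq_b1. Qed.

(** [transfer] takes nonnegative weights, so [w] is shifted by its bound: the weight [w + B] is
    compared with its mean, the constant [c]. Subtracting [B E[f(X)]] restores [w]. Boundedness is
    asked of [w] alone; [f(X)] is merely integrable, which leaves room for a matrix entry as a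
    factor. *)
Lemma Rintegral_indep (X w : T -> R) (B : R) (f : R -> R) :
  measurable_fun setT X -> measurable_fun setT w -> (forall t, `|w t| <= B) ->
  (forall A : set R, measurable A ->
    \int[P]_t (\1_A (X t) * w t) = \int[P]_t \1_A (X t) * \int[P]_t w t) ->
  measurable_fun setT f -> rint P (f \o X) ->
  rint P (fun t => f (X t) * w t) /\
  \int[P]_t (f (X t) * w t) = \int[P]_t f (X t) * \int[P]_t w t.
Proof.
move=> mX mw wB hA mf ifX.
have iw : rint P w by exact: rint_bounded wB.
have icst (a : R) : rint P (fun=> a) by exact: finite_measure_integrable_cst.
have iwB : rint P (fun t => w t + B) by exact: rintD.
have wB0 t : 0 <= w t + B by have := wB t; rewrite ler_norml; lra.
pose c := \int[P]_t (w t + B).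
have cE : c = \int[P]_t w t + B by rewrite /c RintegralD// Rintegral_prob_cst.
have c0 : 0 <= c by apply: Rintegral_ge0.
have iA A : measurable A -> rint P (fun t => \1_A (X t)).
  move=> mA; apply: (@rint_bounded _ 1).
    exact/(measurableT_comp _ mX)/measurable_indic.
  by move=> t; exact: indic1.
have icX : rint P (fun t => f (X t) * c).
  rewrite (_ : EFin \o _ = EFin \o (fun t => c * f (X t))); first exact: rintZ.
  by apply/funext => t /=; rewrite mulrC.
have [|||i1 e1] := @transfer _ _ T T R P P X X mX mX
    (fun t => w t + B) (cst c) _ _ wB0 (fun=> c0) _ f mf icX => //.
- exact: measurable_funD.
- move=> A mA.
  have iAw : rint P (fun t => \1_A (X t) * w t).
    apply: (rint_bounded (B := B)) => [|t].
      by apply: measurable_funM => //; exact: rint_measurable (iA A mA).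
    by rewrite normrM (le_trans _ (wB t))// ler_piMl.
  have i2 : rint P (fun t => \1_A (X t) * (w t + B)).
    rewrite (_ : EFin \o _ = EFin \o (fun t => \1_A (X t) * w t + B * \1_A (X t))).
      by apply: rintD => //; exact: rintZ (iA A mA).
    by apply/funext => t /=; rewrite mulrDr [B * _]mulrC.
  have i3 : rint P (fun t => \1_A (X t) * cst c t).
    rewrite (_ : EFin \o _ = EFin \o (fun t => c * \1_A (X t))).
      exact: rintZ (iA A mA).
    by apply/funext => t /=; rewrite mulrC.
  rewrite -[LHS]fineK; last exact: (integrable_fin_num _ i2).
  rewrite -[RHS]fineK; last exact: (integrable_fin_num _ i3).
  congr EFin; rewrite -/(Rintegral _ _ _) -/(Rintegral _ _ _) RintegralZr//; last exact: iA.
  rewrite cE mulrDr -hA// -RintegralZr//; last exact: iA.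
  rewrite -RintegralD//; first by apply: eq_Rintegral => t _; ring.
  rewrite (_ : EFin \o _ = EFin \o (fun t => B * \1_A (X t))).
    exact: rintZ (iA A mA).
  by apply/funext => t /=; rewrite mulrC.
have iBX : rint P (fun t => f (X t) * B).
  rewrite (_ : EFin \o _ = EFin \o (fun t => B * f (X t))); first exact: rintZ.
  by apply/funext => t /=; rewrite mulrC.
have E : (fun t => f (X t) * w t) = (fun t => f (X t) * (w t + B) - f (X t) * B).
  by apply/funext => t; ring.
split; first by rewrite E; exact: rintB.
rewrite E RintegralB// e1 !RintegralZr// cE; ring.
Qed.

Lemma Cint_indep (X : T -> R) (W : T -> R[i]) (B : R) (f : R -> R[i]) :
  measurable_fun setT X -> cmeasurable W -> (forall t, Normc.normc (W t) <= B) ->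
  (forall A : set R, measurable A ->
    Cint P (fun t => Complex (\1_A (X t)) 0 * W t) =
    Complex (\int[P]_t \1_A (X t)) 0 * Cint P W) ->
  cmeasurable f -> cintegrable P (f \o X) ->
  cintegrable P (fun t => f (X t) * W t) /\
  Cint P (fun t => f (X t) * W t) = Cint P (f \o X) * Cint P W.
Proof.
move=> mX [mW1 mW2] WB hA [mf1 mf2] [i1 i2].
have WB1 t : `|complex.Re (W t)| <= B by rewrite (le_trans (ge_Re_normc _)).
have WB2 t : `|complex.Im (W t)| <= B by rewrite (le_trans (ge_Im_normc _)).
have h1 A : measurable A -> \int[P]_t (\1_A (X t) * complex.Re (W t)) =
    \int[P]_t \1_A (X t) * \int[P]_t complex.Re (W t).
  move=> mA; have /(congr1 (@complex.Re R)) := hA A mA.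
  rewrite ReM /= mul0r subr0 => <-; apply: eq_Rintegral => t _.
  by rewrite ReM /= mul0r subr0.
have h2 A : measurable A -> \int[P]_t (\1_A (X t) * complex.Im (W t)) =
    \int[P]_t \1_A (X t) * \int[P]_t complex.Im (W t).
  move=> mA; have /(congr1 (@complex.Im R)) := hA A mA.
  rewrite ImM /= mul0r addr0 => <-; apply: eq_Rintegral => t _.
  by rewrite ImM /= mul0r addr0.
have [i11 e11] := Rintegral_indep mX mW1 WB1 h1 mf1 i1.
have [i12 e12] := Rintegral_indep mX mW2 WB2 h2 mf1 i1.
have [i21 e21] := Rintegral_indep mX mW1 WB1 h1 mf2 i2.
have [i22 e22] := Rintegral_indep mX mW2 WB2 h2 mf2 i2.
split.
  split; [under eq_fun do rewrite ReM; exact: rintB|].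
  by under eq_fun do rewrite ImM; exact: rintD.
apply/eqP; rewrite eq_complex ReM ImM; apply/andP; split; apply/eqP => /=.
  rewrite -e11 -e22 -RintegralB//; apply: eq_Rintegral => t _; exact: ReM.
rewrite -e12 -e21 -RintegralD//; apply: eq_Rintegral => t _; exact: ImM.
Qed.

Context (I : finType) (X : I -> {RV P >-> R}).
Hypothesis hind : mutually_independent X.

Definition indic_on (J : {set I}) (B : I -> set R) (t : T) : R :=
  \prod_(i in J) \1_(B i) (X i t).

Let mX i : measurable_fun setT (X i).
Proof. exact: measurable_funPT. Qed.

Let indic_on_measurable J B : (forall i, measurable (B i)) ->
  measurable_fun setT (indic_on J B).
Proof.
move=> mB; rewrite /indic_on; under eq_fun do rewrite -big_filter.
apply: measurable_prod => i _.
exact/(measurableT_comp _ (mX i))/measurable_indic.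
Qed.

Let indic_on_norm J B t : `|indic_on J B t| <= 1.
Proof.
apply: (big_ind (fun x : R => `|x| <= 1)) => [|x y x1 y1|i _]; rewrite ?normr1//.
by rewrite normrM mulr_ile1.
Qed.

Let Rintegral_indic_on J B : (forall i, measurable (B i)) ->
  \int[P]_t indic_on J B t = \prod_(i in J) \int[P]_t \1_(B i) (X i t).
Proof.
move=> mB.
have mA i : measurable (X i @^-1` B i).
  by rewrite -[X in measurable X]setTI; exact: mX.
have E i : \int[P]_t \1_(B i) (X i t) = fine (P (X i @^-1` B i)).
  rewrite /Rintegral -[in RHS](setIT (X i @^-1` B i)) -integral_indic//.
have mC : measurable (\bigcap_(i in [set` J]) (X i @^-1` B i)).
  by apply: fin_bigcap_measurable => //; exact: finite_finset.
have indE t : indic_on J B t = \1_(\bigcap_(i in [set` J]) (X i @^-1` B i)) t.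
  rewrite [RHS]indicE; case: (boolP (t \in _)) => [/set_mem h|/negP h].
    by rewrite /indic_on big1// => i iJ; rewrite indicE mem_set//; exact: h.
  rewrite /indic_on; apply/eqP/prodf_eq0.
  have [i iJ Bi] : exists2 i, i \in J & ~ B i (X i t).
    apply: contrapT => h'; apply: h; apply/mem_set => i /= iJ.
    by apply: contrapT => h2; apply: h'; exists i.
  by exists i => //; rewrite indicE memNset.
under eq_Rintegral do rewrite indE.
rewrite /Rintegral integral_indic// setIT.
transitivity (fine (\prod_(i in J) P (X i @^-1` B i))%E).
  by congr fine; exact: hind.
rewrite [RHS](eq_bigr (fun i => fine (P (X i @^-1` B i)))); last by move=> i _; exact: E.
rewrite (_ : (\prod_(i in J) P (X i @^-1` B i))%E =
  (\prod_(i in J) fine (P (X i @^-1` B i)))%:E)//.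
rewrite (big_morph EFin (op1 := *%E) (id1 := 1%E))//.
by apply: eq_bigr => i _; rewrite fineK//; exact: prob_fin.
Qed.

Let Cint_real (w : T -> R) : Cint P (fun t => Complex (w t) 0) =
  Complex (\int[P]_t w t) 0.
Proof. by congr Complex; rewrite Rintegral_prob_cst. Qed.

Section product.
Variable f : I -> R -> R[i].
Hypotheses (mf : forall i, cmeasurable (f i))
  (f1 : forall i y, Normc.normc (f i y) <= 1).

(** Mixed product: the indices in [r] carry the functions [f s], those in [J] carry indicators. The
    induction behind the product formula trades the former for the latter. *)
Let W (r : seq I) J B t : R[i] :=
  (\prod_(s <- r) f s (X s t)) * Complex (indic_on J B t) 0.

Let cmM (F G : T -> R[i]) : cmeasurable F -> cmeasurable G ->
  cmeasurable (fun t => F t * G t).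
Proof.
move=> [F1 F2] [G1 G2]; split.
  by under eq_fun do rewrite ReM; apply: measurable_funB; exact: measurable_funM.
by under eq_fun do rewrite ImM; apply: measurable_funD; exact: measurable_funM.
Qed.

Let cmf i : cmeasurable (fun t => f i (X i t)).
Proof.
have [h1 h2] := mf i; split.
  exact: (measurableT_comp h1 (mX i)).
exact: (measurableT_comp h2 (mX i)).
Qed.

Let mW r J B : (forall i, measurable (B i)) -> cmeasurable (W r J B).
Proof.
move=> mB; apply: cmM; last by split => //; exact: indic_on_measurable.
elim: r => [|s r IH].
  by split; under eq_fun do rewrite big_nil; exact: measurable_cst.
under eq_fun do rewrite big_cons.
by apply: cmM.
Qed.

Let W_norm r J B t : Normc.normc (W r J B t) <= 1.
Proof.
rewrite normcM normc_real; apply: mulr_ile1 => //; first exact: normc_ge0.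
elim: r => [|s r IH]; first by rewrite big_nil /= expr0n addr0 expr1n sqrtr1.
rewrite big_cons normcM; apply: mulr_ile1 => //; exact: normc_ge0.
Qed.

Let W_cons s r (J : {set I}) (A : set R) (B : I -> set R) t : s \notin J ->
  Complex (\1_A (X s t)) 0 * W r J B t =
  W r (s |: J) (fun i => if i == s then A else B i) t.
Proof.
move=> sJ; rewrite /W mulrCA; congr (_ * _).
rewrite /indic_on big_setU1//= eqxx.
rewrite [in RHS](eq_bigr (fun i => \1_(B i) (X i t))); last first.
  by move=> i iJ; case: (eqVneq i s) => [E|//]; rewrite -E iJ in sJ.
apply/eqP; rewrite eq_complex ReM ImM /=; apply/andP; split; apply/eqP; ring.
Qed.

Let icf i : cintegrable P (f i \o X i).
Proof.
have [m1 m2] := cmf i.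
split; apply: (rint_bounded (B := 1)) => // t; apply: le_trans (f1 i (X i t)).
  exact: ge_Re_normc.
exact: ge_Im_normc.
Qed.

(** To split off [f s], [Cint_indep] asks for the formula with an indicator in place of [f s]. By
    [W_cons] this is the same statement for the shorter list and the set [s |: J], so the induction
    on [r] has to leave [J] and [B] arbitrary. For empty [r] it is the independence of events. *)
Let Cint_W r : uniq r -> forall (J : {set I}) (B : I -> set R),
  (forall i, measurable (B i)) ->
  (forall i, i \in r -> i \notin J) ->
  Cint P (W r J B) = \prod_(s <- r) Cint P (f s \o X s) *
    Complex (\prod_(i in J) \int[P]_t \1_(B i) (X i t)) 0.
Proof.
elim: r => [_ J B mB _|s r IH /= /andP[sr ur] J B mB rJ].
  rewrite big_nil mul1r -Rintegral_indic_on// -Cint_real.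
  by congr Cint; apply/funext => t; rewrite /W big_nil mul1r.
have sJ : s \notin J by apply: rJ; rewrite mem_head.
have rJ' i : i \in r -> i \notin J by move=> ir; apply: rJ; rewrite inE ir orbT.
have -> : W (s :: r) J B = (fun t => f s (X s t) * W r J B t).
  by apply/funext => t; rewrite /W big_cons mulrA.
have [|_ ->] := Cint_indep (mX s) (mW r J mB) (W_norm r J B) _ (mf s) (icf s).
- move=> A mA; under eq_fun do rewrite W_cons//.
  have mB' i : measurable (if i == s then A else B i) by case: ifP.
  rewrite IH// => [|i ir]; last first.
    rewrite in_setU1 negb_or rJ'// andbT.
    by apply: contraNneq sr => <-.
  rewrite IH// mulrCA; congr (_ * _).
  rewrite big_setU1//= eqxx.
  rewrite (eq_bigr (fun i => \int[P]_t \1_(B i) (X i t))); last first.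
    by move=> i iJ; case: (eqVneq i s) => [E|//]; rewrite -E iJ in sJ.
  by apply/eqP; rewrite eq_complex ReM ImM /=; apply/andP; split; apply/eqP; ring.
- by rewrite IH// big_cons mulrA.
Qed.

(** The factor [f0] is only integrable while the others are bounded by 1: in [row_coef], [f0] is an
    entry times its exponential and the others are pure exponentials. *)
Lemma Cint_prod (i : I) (r : seq I) (f0 : R -> R[i]) : uniq (i :: r) ->
  cmeasurable f0 -> cintegrable P (f0 \o X i) ->
  cintegrable P (fun t => f0 (X i t) * \prod_(s <- r) f s (X s t)) /\
  Cint P (fun t => f0 (X i t) * \prod_(s <- r) f s (X s t)) =
  Cint P (f0 \o X i) * \prod_(s <- r) Cint P (f s \o X s).
Proof.
move=> /= /andP[ir ur] mf0 if0.
have mT (j : I) : measurable [set: R] by [].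
have WE : W r finset.set0 (fun=> setT) = (fun t => \prod_(s <- r) f s (X s t)).
  by apply/funext => t; rewrite /W /indic_on big_set0 mulr1.
have r0 j : j \in r -> j \notin (finset.set0 : {set I}) by rewrite finset.inE.
have W0 := Cint_W ur mT r0.
rewrite big_set0 mulr1 WE in W0.
have := mW r finset.set0 mT; rewrite WE => mW0.
have W1 := W_norm r finset.set0 (fun=> setT); rewrite WE in W1.
have [A mA|i1 ->] := Cint_indep (mX i) mW0 W1 _ mf0 if0.
- have i0 : i \notin (finset.set0 : {set I}) by rewrite finset.inE.
  transitivity (Cint P (W r (i |: finset.set0)
      (fun j => if j == i then A else setT))).
    by congr Cint; apply/funext => t; rewrite -W_cons// WE.
  rewrite Cint_W//.
  + rewrite W0 mulrC; congr (_ * _).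
    by rewrite big_setU1//= eqxx big_set0 mulr1.
  + by move=> j; case: ifP.
  + by move=> j jr; rewrite finset.setU0 finset.inE; apply: contraNneq ir => <-.
- by rewrite W0.
Qed.

End product.

End independence.

(** * Bounds and measurability of sines and cosines *)

Section trigonometric_bounds.
Context {R : realType}.

Lemma normr_sin_le1 (a : R) : `|sin a| <= 1.
Proof. by rewrite ler_norml sin_geN1 sin_le1. Qed.

Lemma normr_cos_le1 (a : R) : `|cos a| <= 1.
Proof. by rewrite ler_norml cos_geN1 cos_le1. Qed.

Lemma measurable_sinM (b : R) : measurable_fun setT (fun y : R => sin (b * y)).
Proof.
apply: continuous_measurable_fun => y.
by apply: (@continuous_comp _ _ _ ( *%R b) sin);
  [exact: mulrl_continuous|exact: continuous_sin].
Qed.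

Lemma measurable_cosM (b : R) : measurable_fun setT (fun y : R => cos (b * y)).
Proof.
apply: continuous_measurable_fun => y.
by apply: (@continuous_comp _ _ _ ( *%R b) cos);
  [exact: mulrl_continuous|exact: continuous_cos].
Qed.

End trigonometric_bounds.

(** * The sawtooth, its Abel means and its jump set *)

Section sawtooth.
Context {R : realType}.
Implicit Types (r t y delta : R) (n N : nat).

(* The Abel means of the Fourier series of the sawtooth: for 0 <= r < 1 it is
   the argument of 1 + r e^(it); at r = 1, cos t = -1 division by 0 gives 0. *)
Definition abel_saw r t : R := atan (r * sin t / (1 + r * cos t)).

Definition saw_sum N r t : R :=
  \sum_(n < N) (-1) ^+ n * r ^+ n.+1 * sin (n.+1%:R * t) / n.+1%:R.

Lemma sin_next a t : sin (a + t) = 2 * cos t * sin a - sin (a - t).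
Proof. by rewrite sinD sinB; ring. Qed.

(** Imaginary part of the finite geometric sum with first term [e^(it)] and ratio [-r e^(it)], with
    the denominator [|1 + r e^(it)|^2] cleared. *)
Lemma geom_sin_sum r t N :
  (1 + 2 * r * cos t + r ^+ 2) * \sum_(n < N) (- r) ^+ n * sin (n.+1%:R * t) =
  sin t - (- r) ^+ N * (sin (N.+1%:R * t) + r * sin (N%:R * t)).
Proof.
elim: N => [|N IH].
  by rewrite big_ord0 mulr0 expr0 mul1r mul0r sin0 mulr0 addr0 mul1r subrr.
rewrite big_ord_recr /= mulrDr IH [(- r) ^+ N.+1]exprSr.
have -> : N.+2%:R * t = N.+1%:R * t + t by rewrite -[N.+2]addn1 natrD mulrDl mul1r.
have -> : N%:R * t = N.+1%:R * t - t by rewrite -[N.+1]addn1 natrD mulrDl mul1r addrK.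
by rewrite (sin_next (N.+1%:R * t) t); ring.
Qed.

Lemma abel_den_ge r t : 0 <= r -> (1 - r) ^+ 2 <= 1 + 2 * r * cos t + r ^+ 2.
Proof.
move=> r0; have := cos_geN1 t => h.
have : 0 <= r * (1 + cos t) by rewrite mulr_ge0//; lra.
rewrite !expr2; lra.
Qed.

Lemma abel_pos r t : 0 <= r -> r < 1 -> 0 < 1 + r * cos t.
Proof.
move=> r0 r1; have := cos_geN1 t => h.
have : 0 <= r * (1 + cos t) by rewrite mulr_ge0//; lra.
lra.
Qed.

Lemma is_derive_abel_saw r t : 0 <= r -> r < 1 ->
  is_derive r 1 (abel_saw ^~ t) (sin t / (1 + 2 * r * cos t + r ^+ 2)).
Proof.
move=> r0 r1; have d0 := abel_pos t r0 r1.
have d1 : 1 + r * cos t != 0 by rewrite gt_eqF.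
have dq : is_derive r 1 (fun r => r * sin t / (1 + r * cos t))
    (sin t / (1 + r * cos t) ^+ 2).
  apply: is_derive_eq.
  rewrite /GRing.scale /=; field.
  exact: d1.
rewrite /abel_saw.
apply: is_derive_eq.
rewrite /GRing.scale /=.
have e : 1 + 2 * r * cos t + r ^+ 2 =
    (1 + r * cos t) ^+ 2 + (r * sin t) ^+ 2.
  by have := cos2Dsin2 t => h; rewrite exprMn (_ : sin t ^+ 2 = 1 - cos t ^+ 2); [ring|lra].
have p0 : 0 < (1 + r * cos t) ^+ 2 + (r * sin t) ^+ 2.
  by rewrite ltr_pwDl ?exprn_gt0// sqr_ge0.
rewrite e; field.
rewrite d1 /= gt_eqF//=.
Qed.

Lemma is_derive_saw_sum N r t :
  is_derive r 1 (saw_sum N ^~ t) (\sum_(n < N) (- r) ^+ n * sin (n.+1%:R * t)).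
Proof.
have -> : saw_sum N ^~ t = \sum_(n < N)
    (fun r => (-1) ^+ n * r ^+ n.+1 * sin (n.+1%:R * t) / n.+1%:R).
  by apply/funext => z; rewrite /saw_sum fct_sumE.
apply: is_derive_sum => i.
have d : is_derive r 1 (fun r : R => r ^+ i.+1) (i.+1%:R * r ^+ i).
  rewrite (_ : (fun r : R => _) = id ^+ i.+1); last first.
    by apply/funext => z; rewrite exprfctE.
  by apply: is_derive_eq; rewrite /GRing.scale /= mulr1.
apply: is_derive_eq; rewrite /GRing.scale /= [(- r) ^+ _]exprNn.
by field; rewrite ?nat1r ?natr1 pnatr_eq0.
Qed.

(** At [r = 0] both functions vanish, and their [r]-derivatives are the sum and a partial sum of one
    geometric series. The mean value theorem thus reduces the estimate to the geometric remainder at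
    some [c <= r], whose numerator is at most [2 r^N] and whose denominator is at least
    [(1 - r)^2]. *)
Lemma abel_saw_approx r t N : 0 <= r -> r < 1 ->
  `|abel_saw r t - saw_sum N r t| <= 2 * r ^+ N / (1 - r) ^+ 2.
Proof.
move=> r0 r1.
pose D (z : R) := abel_saw z t - saw_sum N z t.
pose D' (z : R) := sin t / (1 + 2 * z * cos t + z ^+ 2) -
  \sum_(n < N) (- z) ^+ n * sin (n.+1%:R * t).
have dD (z : R) : 0 <= z -> z < 1 -> is_derive z 1 D (D' z).
  move=> z0 z1.
  exact: (is_deriveB (is_derive_abel_saw t z0 z1) (is_derive_saw_sum N z t)).
have [z|//|c] := @MVT_segment _ D D' 0 r r0.
- by rewrite in_itv /= => /andP[z0 zr]; apply: dD; [exact: ltW|exact: lt_trans r1].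
- apply: derivable_within_continuous => z; rewrite in_itv /= => /andP[z0 zr].
  have := dD z z0 (le_lt_trans zr r1) => h; exact: ex_derive.
rewrite in_itv /= => /andP[c0 cr] E.
have D0 : D 0 = 0.
  rewrite /D /abel_saw !mul0r atan0 /saw_sum big1 ?subr0// => i _.
  by rewrite expr0n /= mulr0 !mul0r.
move: E; rewrite D0 !subr0 /D => ->.
have c1 : c < 1 by exact: le_lt_trans r1.
pose q := 1 + 2 * c * cos t + c ^+ 2.
have qc : (1 - r) ^+ 2 <= q.
  apply: le_trans (abel_den_ge t c0); rewrite ler_sqr ?nnegrE; lra.
have p0 : 0 < (1 - r) ^+ 2 by rewrite exprn_gt0//; lra.
have q0 : 0 < q by exact: lt_le_trans qc.
have -> : D' c = (- c) ^+ N * (sin (N.+1%:R * t) + c * sin (N%:R * t)) / q.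
  have := geom_sin_sum c t N; rewrite -/q => /(canRL (mulKf (lt0r_neq0 q0))).
  by rewrite /D' -/q => ->; field; exact: lt0r_neq0.
have sb := @normr_sin_le1 R.
rewrite !normrM normfV (ger0_norm (ltW q0)) (ger0_norm r0) normrX normrN (ger0_norm c0).
have b2 : `|sin (N.+1%:R * t) + c * sin (N%:R * t)| <= 2.
  rewrite (le_trans (ler_normD _ _))// normrM (ger0_norm c0) -[leRHS]/(1 + 1).
  by rewrite lerD// mulr_ile1// ltW.
rewrite -[leRHS]mulr1 ler_pM//; last exact: ltW.
  by rewrite !mulr_ge0// ?exprn_ge0// invr_ge0 ltW.
rewrite ler_pM// ?mulr_ge0// ?exprn_ge0// ?invr_ge0 ?(ltW q0)//.
  by rewrite [2 * _]mulrC ler_pM// ?exprn_ge0// lerXn2r.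
by rewrite lef_pV2.
Qed.

Lemma abel_saw_bounded r t : `|abel_saw r t| <= pi / 2.
Proof. by rewrite ler_norml !ltW// ?atan_gtNpi2// atan_ltpi2. Qed.

Lemma cvg_abel_saw t (r_ : nat -> R) : r_ n @[n --> \oo] --> (1 : R) ->
  abel_saw (r_ n) t @[n --> \oo] --> abel_saw 1 t.
Proof.
(* At a jump point [sin t = 0], so every mean is 0 there and agrees with [abel_saw 1], whose
   numerator vanishes as well. *)
move=> r1; have [h|h] := eqVneq (1 + cos t) 0.
  have s0 : sin t = 0.
    have := cos2Dsin2 t; rewrite (_ : cos t = -1); last by lra.
    rewrite sqrrN expr1n => H; apply/eqP; rewrite -sqrf_eq0; apply/eqP; lra.
  rewrite /abel_saw s0 !mulr0 !mul0r.
  by under eq_fun do rewrite mulr0 mul0r; exact: cvg_cst.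
rewrite /abel_saw; apply: continuous_cvg; first exact: continuous_atan.
apply: cvgM; first by apply: cvgM => //; exact: cvg_cst.
apply: cvgV; first by rewrite mul1r.
by apply: cvgD; [exact: cvg_cst|apply: cvgM => //; exact: cvg_cst].
Qed.

Definition quant_phase delta y : R := 2 * pi * y / delta.

Let cos_sin_int y (z : int) :
  cos (y + 2 * pi * z%:~R) = cos y /\ sin (y + 2 * pi * z%:~R) = sin y.
Proof.
have aux (n : nat) (w : R) : cos (w + 2 * pi * n%:R) = cos w /\ sin (w + 2 * pi * n%:R) = sin w.
  rewrite (_ : 2 * pi * n%:R = (pi *+ 2) *+ n); last first.
    by rewrite -[RHS]mulr_natr -[pi *+ 2]mulr_natl.
  by rewrite (periodicn (@cosD2pi R)) (periodicn (@sinD2pi R)).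
case: z => n; first exact: aux.
rewrite NegzE intrN mulrN; have [<- <-] := aux n.+1 (y - 2 * pi * n.+1%:R).
by rewrite subrK.
Qed.

Lemma quant_errorE delta y : 0 < delta ->
  y - quant delta y =
  delta / pi * abel_saw 1 (quant_phase delta y) +
  delta / 2 * (cos (quant_phase delta y) == -1)%:R.
Proof.
move=> d0; have pi0 := @pi_gt0 R.
have [n qn] : exists n : int, quant delta y = n%:~R * delta.
  by eexists; rewrite /quant mulrC.
have := (@quantP _ delta y n d0).1 qn => /andP[y1 y2]; rewrite qn.
(* Half the phase, reduced to []-pi/2, pi/2]] by the nearest multiple of [delta]. In the interior
   [sin(2v) / (1 + cos(2v)) = tan v], and [atan] returns [v]. At the closed endpoint [v = pi/2] the
   arctangent term is 0 while the error is [delta / 2], which the second summand supplies. *)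
pose v := pi * (y / delta - n%:~R).
have dn : delta != 0 by rewrite gt_eqF.
have pn : pi != 0 :> R by rewrite gt_eqF.
have yE : y = delta / pi * v + n%:~R * delta.
  rewrite /v; move: pn; generalize (pi : R) => p p0; field.
  by rewrite dn p0.
have [cE sE] : cos (quant_phase delta y) = cos (v + v) /\
    sin (quant_phase delta y) = sin (v + v).
  have := cos_sin_int (v + v) n; rewrite (_ : _ + _ * _ = quant_phase delta y)//.
  by rewrite /quant_phase /v; field; rewrite gt_eqF.
have v1 : - (pi / 2) < v.
  rewrite -subr_gt0 (_ : v - _ = pi / delta * (y - (n%:~R * delta - delta / 2))).
    by rewrite mulr_gt0 ?divr_gt0// subr_gt0.
  by rewrite /v; field; rewrite gt_eqF.
have v2 : v <= pi / 2.
  rewrite -subr_ge0 (_ : _ - v = pi / delta * (n%:~R * delta + delta / 2 - y)).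
    by rewrite mulr_ge0 ?divr_ge0 ?subr_ge0// ltW.
  by rewrite /v; field; rewrite gt_eqF.
rewrite /abel_saw cE sE !mul1r.
have [vE|vN] := eqVneq v (pi / 2).
  have -> : v + v = pi by rewrite vE; field.
  rewrite cospi sinpi mul0r atan0 mulr0 add0r eqxx mulr1 yE vE.
  by move: pn; generalize (pi : R) => p p0; field.
have v3 : v < pi / 2 by rewrite lt_neqAle vN.
have cv : 0 < cos v by apply: cos_gt0_pihalf; rewrite v1.
have c2 : 1 + cos (v + v) = 2 * cos v ^+ 2.
  by rewrite cosD; have := cos2Dsin2 v; rewrite !expr2; lra.
have tE : sin (v + v) / (1 + cos (v + v)) = tan v.
  by rewrite c2 sinD /tan; field; rewrite gt_eqF.
rewrite tE.
rewrite tanK ?in_itv/= ?v1// (_ : (_ == -1) = false) ?mulr0 ?addr0.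
  by rewrite {1}yE; ring.
apply/negbTE; apply: contraTneq cv => h; move: c2; rewrite h subrr => /esym/eqP.
by rewrite mulf_eq0 sqrf_eq0 => /orP[|/eqP->]; rewrite ?ltxx// pnatr_eq0.
Qed.

(** Real part of the finite geometric sum with ratio [-e^(it)], with the denominator
    [|1 + e^(it)|^2 = 2 + 2 cos t] cleared. *)
Lemma cesaro_cos_sum t N :
  (2 + 2 * cos t) * \sum_(n < N) (-1) ^+ n * cos (n%:R * t) =
  1 + cos t - (-1) ^+ N *
    (cos (N%:R * t) + cos (N%:R * t) * cos t + sin (N%:R * t) * sin t).
Proof.
elim: N => [|N IH].
  by rewrite big_ord0 mulr0 expr0 mul1r mul0r sin0 cos0 mul0r addr0 mul1r subrr.
rewrite big_ord_recr /= mulrDr IH [(-1) ^+ N.+1]exprSr.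
have -> : N.+1%:R * t = N%:R * t + t by rewrite -[N.+1]addn1 natrD mulrDl mul1r.
rewrite cosD sinD.
have -> : cos (N%:R * t) * cos t - sin (N%:R * t) * sin t +
    (cos (N%:R * t) * cos t - sin (N%:R * t) * sin t) * cos t +
    (sin (N%:R * t) * cos t + cos (N%:R * t) * sin t) * sin t =
    cos (N%:R * t) * cos t - sin (N%:R * t) * sin t + cos (N%:R * t) *
    (cos t ^+ 2 + sin t ^+ 2) by ring.
by rewrite cos2Dsin2; ring.
Qed.

Definition cesaro_cos N t : R :=
  N.+1%:R^-1 * \sum_(n < N.+1) (-1) ^+ n * cos (n%:R * t).

Let cos_bounded := @normr_cos_le1 R.

Let sin_bounded := @normr_sin_le1 R.

Lemma cesaro_cos_bounded N t : `|cesaro_cos N t| <= 1.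
Proof.
rewrite normrM ger0_norm// mulrC ler_pdivrMr// mul1r.
rewrite (le_trans (ler_norm_sum _ _ _))// -[leRHS]mulr1 mulr_natl.
rewrite -[X in _ <= _ *+ X]card_ord -sumr_const ler_sum// => i _.
by rewrite normrM normrX normrN1 expr1n mul1r.
Qed.

Lemma cvg_cesaro_cos t :
  cesaro_cos N t @[N --> \oo] --> ((cos t == -1)%:R : R).
Proof.
have [h|h] := eqVneq (cos t) (-1).
  have s0 : sin t = 0.
    have := cos2Dsin2 t; rewrite h sqrrN expr1n => H.
    by apply/eqP; rewrite -sqrf_eq0; apply/eqP; lra.
  have cn n : (-1) ^+ n * cos (n%:R * t) = 1 /\ sin (n%:R * t) = 0.
    elim: n => [|n [IH1 IH2]]; first by rewrite mul0r cos0 sin0 mulr1.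
    rewrite -[in _%:R]addn1 natrD mulrDl mul1r cosD sinD IH2 h s0 exprS; split; last by ring.
    by rewrite -[RHS]IH1; ring.
  rewrite (_ : cesaro_cos ^~ t = cst 1); first exact: cvg_cst.
  apply/funext => N; rewrite /cesaro_cos.
  under eq_bigr do rewrite (cn _).1.
  by rewrite sumr_const card_ord mulVf// pnatr_eq0.
have c0 : 0 < 2 + 2 * cos t.
  have := cos_geN1 t; rewrite le_eqVlt eq_sym (negbTE h) /=; lra.
apply/norm_cvg0P.
(* Away from the jumps the sums stay bounded and the averaging factor sends them to 0. The 5 is
   [2 + 3]: at most 2 from [1 + cos t] and at most 3 from the bracket after [(-1) ^+ N] in
   [cesaro_cos_sum]. *)
have bnd N : `|cesaro_cos N t| <= N.+1%:R^-1 * (5 / (2 + 2 * cos t)).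
  rewrite normrM ger0_norm// ler_wpM2l// ler_pdivlMr//.
  rewrite -[X in _ * X <= _](gtr0_norm c0) mulrC -normrM cesaro_cos_sum.
  rewrite (le_trans (ler_normB _ _))// normrM normrX normrN1 expr1n mul1r.
  have h1 := ler_normD 1 (cos t); rewrite normr1 in h1.
  have h2 := cos_bounded t.
  set a := N.+1%:R * t.
  have h3 : `|cos a + cos a * cos t + sin a * sin t| <= 3.
    rewrite (le_trans (ler_normD _ _))// (_ : 3 = 1 + 1 + 1); last by ring.
    rewrite lerD ?normrM ?mulr_ile1// (le_trans (ler_normD _ _))//.
    by rewrite lerD ?normrM ?mulr_ile1.
  by lra.
apply: (@squeeze_cvgr _ _ _ _ (cst 0) (fun N => N.+1%:R^-1 * (5 / (2 + 2 * cos t)))).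
- by apply: nearW => N /=; rewrite normr_ge0 bnd.
- exact: cvg_cst.
- rewrite -[X in _ --> X](mul0r (5 / (2 + 2 * cos t))); apply: cvgMl.
  exact: cvg_harmonic.
Qed.

End sawtooth.

Lemma rintM_bounded d (T : measurableType d) (R : realType)
    (mu : {measure set T -> \bar R}) (X g : T -> R) (B : R) :
  rint mu X -> measurable_fun setT g -> (forall t, `|g t| <= B) ->
  rint mu (fun t => X t * g t).
Proof.
move=> iX mg gB.
have iB : rint mu (fun t => B * `|X t|) by apply: rintZ; exact: integrable_norm.
apply: rint_le iB => [|t]; last by rewrite normrM mulrC ler_wpM2r.
by apply: measurable_funM => //; exact: rint_measurable iX.
Qed.

(** * Expectation of a variable times the quantization error *)

Section quantization_error.
Context d (T : measurableType d) (R : realType) (P : probability T R).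
Variables (X Y : T -> R) (delta : R).
Hypotheses (iX : rint P X) (mY : measurable_fun setT Y) (delta_gt0 : 0 < delta).

Let theta t := quant_phase delta (Y t).
Definition sin_coef n : R := \int[P]_t (X t * sin (n%:R * theta t)).
Definition cos_coef n : R := \int[P]_t (X t * cos (n%:R * theta t)).

(** Summability of the sine coefficients in telescoped form: [w N] bounds the sum of all terms from
    index [N] on. *)
Variable w : nat -> R.
Hypothesis w0 : w n @[n --> \oo] --> (0 : R).
Hypothesis sin_coef_le : forall n, `|sin_coef n.+1 / n.+1%:R| <= w n - w n.+1.
Hypothesis cvg_cos_coef : cos_coef n @[n --> \oo] --> (0 : R).

Let mtheta : measurable_fun setT theta.
Proof.
rewrite /theta /quant_phase; apply: measurable_funM => //.
exact: measurable_funM.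
Qed.

Let msin a : measurable_fun setT (fun t => sin (a * theta t)).
Proof.
apply: (measurableT_comp (f := sin)).
  by apply: continuous_measurable_fun => z; exact: continuous_sin.
exact: measurable_funM.
Qed.

Let mcos a : measurable_fun setT (fun t => cos (a * theta t)).
Proof.
apply: (measurableT_comp (f := cos)).
  by apply: continuous_measurable_fun => z; exact: continuous_cos.
exact: measurable_funM.
Qed.

Let isin a : rint P (fun t => X t * sin (a * theta t)).
Proof.
apply: (rintM_bounded (B := 1) iX) => // t.
exact: normr_sin_le1.
Qed.

Let icos a : rint P (fun t => X t * cos (a * theta t)).
Proof. exact: (rintM_bounded iX (mcos a) (fun=> normr_cos_le1 _)). Qed.

Let psum r N : R :=
  \sum_(n < N) (-1) ^+ n * r ^+ n.+1 * (sin_coef n.+1 / n.+1%:R).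

Let msaw_lt1 r : 0 <= r -> r < 1 -> measurable_fun setT (fun t => abel_saw r (theta t)).
Proof.
move=> r0 r1; apply: (measurableT_comp (f := abel_saw r)) => //.
apply: continuous_measurable_fun => z; rewrite /abel_saw.
apply: (@continuous_comp _ _ _ (fun t => r * sin t / (1 + r * cos t)) atan);
  last exact: continuous_atan.
apply: cvgM; first by apply: cvgM; [exact: cvg_cst|exact: continuous_sin].
apply: cvgV; first by rewrite gt_eqF// abel_pos.
apply: cvgD; first exact: cvg_cst.
by apply: cvgM; [exact: cvg_cst|exact: continuous_cos].
Qed.

Let radius n : R := 1 - n.+1%:R^-1.

Let radius_ge0 n : 0 <= radius n.
Proof. by rewrite subr_ge0 invf_le1// ler1n. Qed.

Let radius_lt1 n : radius n < 1.
Proof. by rewrite ltrBlDr ltrDl invr_gt0. Qed.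

Let cvg_radius : radius n @[n --> \oo] --> (1 : R).
Proof.
rewrite -[X in _ --> X]subr0; apply: cvgB; first exact: cvg_cst.
exact: cvg_harmonic.
Qed.

(** [abel_saw 1] is discontinuous at the jumps, so its measurability is inherited from the
    continuous means with [r < 1]. *)
Let msaw : measurable_fun setT (fun t => abel_saw 1 (theta t)).
Proof.
apply: (measurable_fun_cvg (h := fun n t => abel_saw (radius n) (theta t))).
  by move=> n; exact: msaw_lt1.
by move=> t _; exact: cvg_abel_saw.
Qed.

Let abel_psum r M : 0 <= r -> r < 1 ->
  `|\int[P]_t (X t * abel_saw r (theta t)) - psum r M| <=
  (\int[P]_t `|X t|) * (2 * r ^+ M / (1 - r) ^+ 2).
Proof.
move=> r0 r1.
have E t : X t * saw_sum M r (theta t) = \sum_(n < M)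
    (-1) ^+ n * r ^+ n.+1 / n.+1%:R * (X t * sin (n.+1%:R * theta t)).
  by rewrite /saw_sum mulr_sumr; apply: eq_bigr => n _; ring.
have iF (n : 'I_M) : rint P (fun t =>
    (-1) ^+ n * r ^+ n.+1 / n.+1%:R * (X t * sin (n.+1%:R * theta t))).
  by apply: rintZ.
have ss : \int[P]_t (X t * saw_sum M r (theta t)) = psum r M.
  under eq_Rintegral do rewrite E.
  rewrite Rintegral_sum//; apply: eq_bigr => n _.
  by rewrite RintegralZl// /sin_coef; ring.
have is1 : rint P (fun t => X t * saw_sum M r (theta t)).
  by under eq_fun do rewrite E; exact: rint_sum.
have is2 : rint P (fun t => X t * abel_saw r (theta t)).
  apply: (rintM_bounded iX) (fun t => abel_saw_bounded r (theta t)).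
  exact: msaw_lt1.
have iX' : rint P (fun t => `|X t|) by exact: integrable_norm.
rewrite -ss -RintegralB// (le_trans (le_normr_Rintegral _ _))//; first exact: rintB.
rewrite -RintegralZr//; apply: le_Rintegral => //.
- by apply: integrable_norm; exact: rintB.
- by under eq_fun do rewrite mulrC; exact: rintZ.
- move=> t _; rewrite -mulrBr normrM ler_wpM2l//.
  exact: abel_saw_approx.
Qed.

Let psum_tail r N M : 0 <= r -> r < 1 -> (N <= M)%N ->
  `|psum r M - psum r N| <= w N - w M.
Proof.
move=> r0 r1; elim: M => [|M IH]; first by rewrite leqn0 => /eqP ->; rewrite !subrr normr0.
rewrite leq_eqVlt => /predU1P[->|]; first by rewrite !subrr normr0.
rewrite ltnS => /IH {}IH.
rewrite {1}/psum big_ord_recr /= -/(psum r M) addrAC (le_trans (ler_normD _ _))//.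
rewrite (_ : w N - w M.+1 = w N - w M + (w M - w M.+1)); last by ring.
apply: lerD => //; apply: le_trans (sin_coef_le M).
rewrite normrM normrM normrX normrN1 expr1n mul1r ler_piMl//.
by rewrite normrX (ger0_norm r0) exprn_ile1// ltW.
Qed.

Let cvg_exprn r : 0 <= r -> r < 1 -> r ^+ n @[n --> \oo] --> (0 : R).
Proof. by move=> r0 r1; apply: cvg_expr; rewrite ger0_norm. Qed.

(** Letting [M] tend to infinity for fixed [r] removes the error bound of [abel_psum], which
    explodes as [r] tends to 1, and leaves the bound [w N], uniform in [r]. Only then may [r] tend
    to 1, in [saw_coef]. *)
Let abel_psum_tail r N : 0 <= r -> r < 1 ->
  `|\int[P]_t (X t * abel_saw r (theta t)) - psum r N| <= w N.
Proof.
move=> r0 r1; set I := \int[P]_t _.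
pose K := (\int[P]_t `|X t|) * (2 / (1 - r) ^+ 2).
have h : r ^+ M * K + (w N - w M) @[M --> \oo] --> 0 * K + (w N - 0).
  apply: cvgD; first by apply: cvgM; [exact: cvg_exprn|exact: cvg_cst].
  by apply: cvgB => //; exact: cvg_cst.
rewrite mul0r add0r subr0 in h.
apply: (cvgr_to_ge h); near=> M.
have NM : (N <= M)%N by near: M; exact: nbhs_infty_ge.
rewrite (_ : I - _ = (I - psum r M) + (psum r M - psum r N)); last by ring.
rewrite (le_trans (ler_normD _ _))// lerD ?psum_tail//.
by rewrite (le_trans (abel_psum M r0 r1))// /K; lra.
Unshelve. all: by end_near. Qed.

Let cvg_abel : \int[P]_t (X t * abel_saw (radius n) (theta t)) @[n --> \oo] -->
  \int[P]_t (X t * abel_saw 1 (theta t)).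
Proof.
have mX := rint_measurable iX.
apply: (@Rintegral_dominated _ _ _ _ _ _ (fun t => pi / 2 * `|X t|)).
- by move=> n; apply: measurable_funM => //; exact: msaw_lt1.
- exact: measurable_funM.
- by move=> t; apply: cvgM; [exact: cvg_cst|exact: cvg_abel_saw].
- by apply: rintZ; exact: integrable_norm.
- by move=> n t; rewrite normrM mulrC ler_wpM2r// abel_saw_bounded.
Qed.

Let saw_coef N :
  `|\int[P]_t (X t * abel_saw 1 (theta t)) - psum 1 N| <= w N.
Proof.
have c1 : psum (radius n) N @[n --> \oo] --> psum 1 N.
  rewrite /psum; elim: N => [|N IH].
    by rewrite big_ord0; under eq_fun do rewrite big_ord0; exact: cvg_cst.
  rewrite big_ord_recr /=; under eq_fun do rewrite big_ord_recr /=.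
  apply: cvgD => //; apply: cvgM; last exact: cvg_cst.
  apply: cvgM; first exact: cvg_cst.
  elim: N.+1 => [|k IHk]; first by rewrite expr0; exact: cvg_cst.
  by rewrite exprS; under eq_fun do rewrite exprS; exact: cvgM.
have c2 : `|\int[P]_t (X t * abel_saw (radius n) (theta t)) - psum (radius n) N|
    @[n --> \oo] --> `|\int[P]_t (X t * abel_saw 1 (theta t)) - psum 1 N|.
  by apply: cvg_norm; exact: cvgB.
apply: (cvgr_to_le c2).
by apply: nearW => n; exact: abel_psum_tail.
Qed.

Let saw_limit : \sum_(n < N) (-1) ^+ n * (sin_coef n.+1 / n.+1%:R) @[N --> \oo] -->
  \int[P]_t (X t * abel_saw 1 (theta t)).
Proof.
apply/cvgrPdist_le => e e0.
have /cvgr_le /(_ e e0) := w0; apply: filterS => N.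
apply: le_trans; apply: le_trans (saw_coef N).
by rewrite /psum; under [in leRHS]eq_bigr do rewrite expr1n mulr1.
Qed.

Let mjump : measurable_fun setT (fun t => (cos (theta t) == -1)%:R : R).
Proof.
apply: (measurable_fun_cvg (h := fun n t => cesaro_cos n (theta t))).
  move=> n; apply: measurable_funM => //; apply: measurable_sum => i.
  exact: measurable_funM.
by move=> t _; exact: cvg_cesaro_cos.
Qed.

(** The integrals of [X] against the Cesaro means are themselves the Cesaro means of
    [(-1)^n cos_coef n], hence tend to 0 with [cos_coef n]; by domination they also tend to the
    integral over the jump set. *)
Let jump0 : \int[P]_t (X t * (cos (theta t) == -1)%:R) = 0.
Proof.
have mX := rint_measurable iX.
have E n t : X t * cesaro_cos n (theta t) = \sum_(i < n.+1)
    n.+1%:R^-1 * (-1) ^+ i * (X t * cos (i%:R * theta t)).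
  by rewrite /cesaro_cos !mulr_sumr; apply: eq_bigr => i _; ring.
have mE n : measurable_fun setT (fun t => X t * cesaro_cos n (theta t)).
  apply: measurable_funM => //.
  apply: measurable_funM => //; apply: measurable_sum => i.
  exact: measurable_funM.
have h : \int[P]_t (X t * cesaro_cos n (theta t)) @[n --> \oo] -->
    \int[P]_t (X t * (cos (theta t) == -1)%:R).
  apply: (@Rintegral_dominated _ _ _ _ _ _ (fun t => 1 * `|X t|)) => //.
  - exact: measurable_funM.
  - by move=> t; apply: cvgM; [exact: cvg_cst|exact: cvg_cesaro_cos].
  - by apply: rintZ; exact: integrable_norm.
  - by move=> n t; rewrite normrM mulrC ler_wpM2r// cesaro_cos_bounded.
have cs : (-1) ^+ n * cos_coef n @[n --> \oo] --> (0 : R).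
  apply/norm_cvg0P; under eq_fun do rewrite normrM normrX normrN1 expr1n mul1r.
  exact/norm_cvg0P.
have := cesaro cs; rewrite (_ : arithmetic_mean _ =
  (fun n => \int[P]_t (X t * cesaro_cos n (theta t)))); last first.
  apply/funext => n; rewrite /arithmetic_mean /series /= big_mkord.
  under eq_Rintegral do rewrite E.
  rewrite Rintegral_sum => [|i]; last exact: rintZ.
  rewrite mulr_sumr; apply: eq_bigr => i _.
  by rewrite RintegralZl// /cos_coef mulrA.
by move=> h0; exact: (cvg_unique _ h h0).
Qed.

Lemma rint_quant_error : rint P (fun t => X t * (Y t - quant delta (Y t))).
Proof.
under eq_fun do rewrite quant_errorE// mulrDr mulrCA [X in _ + X]mulrCA.
apply: rintD; apply: rintZ.
  exact: (rintM_bounded iX msaw (fun t => abel_saw_bounded 1 (theta t))).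
by apply: (rintM_bounded (B := 1) iX mjump) => t; case: eqP => _; rewrite ?normr1 ?normr0.
Qed.

Lemma cvg_quant_error :
  delta / pi * \sum_(n < N) (-1) ^+ n * (sin_coef n.+1 / n.+1%:R) @[N --> \oo] -->
  \int[P]_t (X t * (Y t - quant delta (Y t))).
Proof.
under [X in _ --> X]eq_Rintegral do
  rewrite quant_errorE// mulrDr mulrCA [X in _ + X]mulrCA.
have i1 := rintM_bounded iX msaw (fun t => abel_saw_bounded 1 (theta t)).
have i2 : rint P (fun t => X t * (cos (theta t) == -1)%:R).
  by apply: (rintM_bounded (B := 1) iX mjump) => t; case: eqP => _; rewrite ?normr1 ?normr0.
rewrite RintegralD//; [|exact: rintZ|exact: rintZ].
rewrite !RintegralZl// jump0 mulr0 addr0.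
by apply: cvgM; [exact: cvg_cst|exact: saw_limit].
Qed.

End quantization_error.

(** * The complex exponential on the imaginary axis *)

Section expi_facts.
Context {R : realType}.

Lemma expiD (a b : R) : expi (a + b) = expi a * expi b.
Proof.
apply/eqP; rewrite eq_complex ReM ImM /= cosD sinD.
by apply/andP; split; apply/eqP => //; ring.
Qed.

Lemma expi0 : expi (0 : R) = 1.
Proof. by rewrite /expi cos0 sin0. Qed.

Lemma normc_expi (a : R) : Normc.normc (expi a) = 1.
Proof. by rewrite /= cos2Dsin2 sqrtr1. Qed.

Lemma expi_sum (I : Type) (s : seq I) (a : I -> R) :
  expi (\sum_(i <- s) a i) = \prod_(i <- s) expi (a i).
Proof.
elim: s => [|i s IH]; first by rewrite !big_nil expi0.
by rewrite !big_cons expiD IH.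
Qed.

Lemma cmeasurable_expi (b : R) : cmeasurable (fun y : R => expi (- (b * y))).
Proof.
have mb : measurable_fun setT (fun y : R => - (b * y)).
  by apply: continuous_measurable_fun => z; apply: cvgN; exact: cvgMr.
split; apply: measurableT_comp => //.
  by apply: continuous_measurable_fun => z; exact: continuous_cos.
by apply: continuous_measurable_fun => z; exact: continuous_sin.
Qed.

End expi_facts.

(** * Rows of the matrix and the factorization of their coefficients *)

Section rows.
Context d (T : measurableType d) (R : realType) (P : probability T R).
Context (m k : nat) (e : 'I_m -> 'I_k -> {RV P >-> R}).
Hypothesis hind : mutually_independent (fun ij : 'I_m * 'I_k => e ij.1 ij.2).
Variables (delta : R) (x : 'cV[R]_k).

Definition measurement (l : 'I_m) (t : T) : R := (random_matrix e t *m x) l 0.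

Lemma measurementE l t : measurement l t = \sum_(s < k) e l s t * x s 0.
Proof. by rewrite /measurement mxE; apply: eq_bigr => s _; rewrite mxE. Qed.

Lemma measurable_entry l i : measurable_fun setT (e l i).
Proof. exact: measurable_funPT. Qed.

Lemma measurable_measurement l : measurable_fun setT (measurement l).
Proof.
rewrite (_ : measurement l = (fun t => \sum_(s < k) e l s t * x s 0)).
  apply: measurable_sum => s; exact: measurable_funM.
by apply/funext => t; exact: measurementE.
Qed.

Lemma residualE i t : residual delta x (random_matrix e t) i 0 =
  \sum_(l < m) e l i t * (measurement l t - quant delta (measurement l t)).
Proof. by rewrite mxE; apply: eq_bigr => l _; rewrite /measurement !mxE. Qed.

Lemma integrable_residual :
  (forall l i, rint P (fun t =>
    e l i t * (measurement l t - quant delta (measurement l t)))) ->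
  integrable_vec P (fun t => residual delta x (random_matrix e t)).
Proof.
move=> h i; under eq_fun do rewrite residualE.
by apply: rint_sum => l.
Qed.

Lemma expectation_residual (v : 'I_k -> R) :
  (forall l i, rint P (fun t =>
    e l i t * (measurement l t - quant delta (measurement l t)))) ->
  (forall l i, \int[P]_t
    (e l i t * (measurement l t - quant delta (measurement l t))) = v i) ->
  forall i, expectation_vec P (fun t => residual delta x (random_matrix e t)) i 0
    = m%:R * v i.
Proof.
move=> hi hv i; rewrite mxE unlock.
rewrite -/(Rintegral P setT _); under eq_Rintegral do rewrite residualE.
rewrite Rintegral_sum//; under eq_bigr do rewrite hv.
by rewrite sumr_const card_ord mulr_natl.
Qed.

(** The left side is [E[X e^(-i n theta)]] for the entry [X = e l i] and the phase [theta] of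
    measurement [l]. Since [theta] is linear in the row, the exponential splits over the columns;
    column [i] keeps the entry and becomes the merely integrable factor of [Cint_prod]. *)
Lemma row_coef l i n : rint P (e l i) ->
  Complex (cos_coef P (e l i) (measurement l) delta n)
    (- sin_coef P (e l i) (measurement l) delta n) =
  Cint P (fun t => Complex (e l i t) 0 *
    expi (- (2 * pi * n%:R * x i 0 / delta * e l i t))) *
  \prod_(s < k | s != i)
    Cint P (fun t => expi (- (2 * pi * n%:R * x s 0 / delta * e l s t))).
Proof.
move=> ie; pose b (ij : 'I_m * 'I_k) := 2 * pi * n%:R * x ij.2 0 / delta.
pose r := [seq (l, s) | s <- index_enum 'I_k & s != i].
have ur : uniq ((l, i) :: r).
  rewrite /= map_inj_uniq ?filter_uniq ?index_enum_uniq ?andbT//; last by move=> ? ? [].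
  by apply/mapP => -[s]; rewrite mem_filter => /andP[+ _] [] => /eqP si E; exact: si.
pose f ij y := expi (- (b ij * y)).
pose f0 y := Complex y 0 * f (l, i) y.
have mf ij : cmeasurable (f ij) by exact: cmeasurable_expi.
have [mf1 mf2] := mf (l, i).
have mid : measurable_fun setT (fun y : R => y) by [].
have mf0 : cmeasurable f0.
  split; under eq_fun do rewrite ?ReM ?ImM /= mul0r ?subr0 ?addr0.
    exact: measurable_funM.
  exact: measurable_funM.
have f1 ij y : Normc.normc (f ij y) <= 1 by rewrite normc_expi.
have if0 : cintegrable P (f0 \o (fun t => e l i t)).
  split; under eq_fun do rewrite /= /f0 ?ReM ?ImM /= mul0r ?subr0 ?addr0.
    apply: (rintM_bounded (B := 1) ie) => [|t].
      exact: (measurableT_comp mf1 (measurable_entry l i)).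
    by rewrite (le_trans (ge_Re_normc _) (f1 _ _)).
  apply: (rintM_bounded (B := 1) ie) => [|t].
    exact: (measurableT_comp mf2 (measurable_entry l i)).
  by rewrite (le_trans (ge_Im_normc _) (f1 _ _)).
have [_] := @Cint_prod _ T R P _ _ hind f mf f1 (l, i) r f0 ur mf0 if0.
rewrite big_map big_filter => <-.
have E t : f0 (e l i t) * \prod_(s <- r) f s (e s.1 s.2 t) =
    Complex (e l i t * cos (n%:R * quant_phase delta (measurement l t)))
      (- (e l i t * sin (n%:R * quant_phase delta (measurement l t)))).
  rewrite big_map big_filter /f0 -mulrA -(bigD1 (P := predT) i)//=.
  rewrite -(expi_sum _ (fun s => - (b (l, s) * e l s t))).
  have -> : \sum_s - (b (l, s) * e l s t) =
      - (n%:R * quant_phase delta (measurement l t)).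
    rewrite measurementE sumrN /quant_phase mulr_sumr mulr_suml mulr_sumr.
    by congr (- _); apply: eq_bigr => s _; rewrite /b /=; ring.
  rewrite /expi cosN sinN.
  by apply/eqP; rewrite eq_complex ReM ImM /=; apply/andP; split; apply/eqP; ring.
rewrite (_ : (fun t => _) = (fun t => Complex
    (e l i t * cos (n%:R * quant_phase delta (measurement l t)))
      (- (e l i t * sin (n%:R * quant_phase delta (measurement l t)))))); last first.
  by apply/funext => t; exact: E.
congr Complex; rewrite /sin_coef -mulN1r -RintegralZl//.
  by apply: eq_Rintegral => t _; rewrite /= mulN1r.
apply: (rintM_bounded (B := 1) ie) => [|t]; last by rewrite ler_norml sin_geN1 sin_le1.
apply: (measurableT_comp (f := sin)).
  by apply: continuous_measurable_fun => z; exact: continuous_sin.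
apply: measurable_funM => //; rewrite /quant_phase; apply: measurable_funM => //.
by apply: measurable_funM => //; exact: measurable_measurement.
Qed.

End rows.

(** * Integrability from decay, and integrals of derivatives on the line *)

Section real_line.
Context {R : realType}.
Local Notation mu := (@lebesgue_measure R).
Implicit Types (f g G : R -> R) (C x : R).

Lemma rint_oneDsqrV : rint mu (fun x => (oneDsqr x)^-1).
Proof.
have c := @continuous_oneDsqrV R.
apply/integrableP; split.
  by apply/measurable_EFinP; exact: continuous_measurable_fun.
under eq_integral => x _ do rewrite /= gtr0_norm ?invr_gt0//.
have p x : 0 <= (oneDsqr x)^-1 by rewrite invr_ge0.
rewrite (ge0_symfun_integralT p c) => [|x]; last by rewrite /= /oneDsqr sqrrN.
by rewrite -set_itvcy integral0y_oneDsqr -EFinM ltry.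
Qed.

Lemma rint_decay f C : measurable_fun setT f ->
  (forall x, `|f x| * (1 + x ^+ 2) <= C) -> rint mu f.
Proof.
move=> mf fC; apply: (rint_le _ _ (rintZ C rint_oneDsqrV)) => [//|x].
by rewrite ler_pdivlMr// /oneDsqr ltr_pwDl// sqr_ge0.
Qed.

(** Over [[-(n+1), n+1]] the integral is a difference of boundary values of [G], which are of order
    [1/n]. For a product [G] this is integration by parts without boundary terms. *)
Lemma Rintegral_derive_eq0 G g C :
  (forall x, is_derive x 1 G (g x)) -> continuous g -> rint mu g ->
  (forall x, `|G x| * (1 + `|x|) <= C) -> \int[mu]_x g x = 0.
Proof.
move=> dG cg ig GC.
pose A n := `[(- n.+1%:R : R), n.+1%:R]%classic.
have mg : measurable_fun setT g by exact: continuous_measurable_fun.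
have mA n : measurable (A n) by exact: measurable_itv.
have h : \int[mu]_x (g \_ (A n)) x @[n --> \oo] --> \int[mu]_x g x.
  apply: (@Rintegral_dominated _ _ _ mu (fun n => g \_ (A n)) g (fun x => `|g x|)) => //.
  - by move=> n; exact: ((measurable_restrictT g (mA n)).1 (measurable_funTS mg)).
  - move=> x; apply: cvg_near_cst; near=> n.
    rewrite patchE mem_set// /A /= in_itv /= -ler_norml.
    rewrite (@le_trans _ _ n%:R) ?ler_nat//.
    by near: n; exact: nbhs_infty_ger.
  - exact: integrable_norm.
  - by move=> n x; rewrite patchE; case: ifP; rewrite ?normr0.
have G0 (u : nat -> R) : (forall n, `|u n| = n.+1%:R) -> G (u n) @[n --> \oo] --> (0 : R).
  move=> un; apply/norm_cvg0P.
  apply: (@squeeze_cvgr _ _ _ _ (cst 0) (fun n => C * n.+1%:R^-1)).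
  - apply: nearW => n /=; rewrite normr_ge0 /= ler_pdivlMr//.
    apply: le_trans (GC (u n)); rewrite ler_wpM2l// un; lra.
  - exact: cvg_cst.
  - rewrite -[X in _ --> X](mulr0 C); apply: cvgMr.
    exact: cvg_harmonic.
have E n : \int[mu]_x (g \_ (A n)) x = G n.+1%:R - G (- n.+1%:R).
  rewrite -Rintegral_mkcond /Rintegral (@continuous_FTC2 _ g G)//.
  - by rewrite gtrN.
  - exact: continuous_subspaceT.
  - have cG x : {for x, continuous G}.
      by apply: differentiable_continuous; apply/derivable1_diffP; have := dG x => h'; exact: ex_derive.
    split.
    + by move=> x _; have := dG x => h'; exact: ex_derive.
    + by apply: cvg_at_right_filter; exact: cG.
    + by apply: cvg_at_left_filter; exact: cG.
  - by move=> x _; rewrite derive1E; have := dG x => h'; exact: derive_val.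
have h2 : G n.+1%:R - G (- n.+1%:R) @[n --> \oo] --> (0 : R).
  rewrite -[X in _ --> X](subr0 0); apply: cvgB; apply: G0 => n.
    by rewrite ger0_norm.
  by rewrite normrN ger0_norm.
have h3 : \int[mu]_x (g \_ (A n)) x @[n --> \oo] --> (0 : R).
  by under eq_fun do rewrite E.
exact: (cvg_unique _ h h3).
Unshelve. all: by end_near. Qed.

End real_line.

(** [transfer] with weight 1 on the probability space and weight [phi] on the line; [has_density] is
    its hypothesis on indicators. *)
Lemma density_transfer d (T : measurableType d) (R : realType)
    (P : probability T R) (X : {RV P >-> R}) (phi f : R -> R) :
  has_density X phi -> measurable_fun setT f ->
  rint lebesgue_measure (fun t => f t * phi t) ->
  rint P (fun t => f (X t)) /\
  \int[P]_t f (X t) = \int[lebesgue_measure]_t (f t * phi t).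
Proof.
move=> [mphi phi0 hA] mf ip.
have mX : measurable_fun setT X by exact: measurable_funPT.
have mid : measurable_fun setT (fun y : R => y) by [].
have one : forall t : T, 0 <= cst (1 : R) t by [].
have [||i1 e1] := @transfer _ _ T (measurableTypeR R) R P lebesgue_measure X id mX mid
    (cst 1) phi _ mphi one phi0 _ f mf ip => //.
  move=> A mA; have := hA A mA.
  have mXA : measurable (X @^-1` A) by rewrite -[X in measurable X]setTI; exact: mX.
  rewrite [in LHS]/distribution /pushforward => E.
  transitivity (P (X @^-1` A)).
    under eq_integral => t _ do rewrite mulr1.
    by rewrite -[RHS](congr1 P (setIT _)) -integral_indic.
  rewrite E [LHS]integral_mkcond; apply: eq_integral => t _.
  by rewrite patchE indicE /=; case: ifP => _; rewrite ?mul1r ?mul0r.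
split.
  by rewrite (_ : EFin \o _ = EFin \o (fun t => f (X t) * cst 1 t))//; apply/funext => t /=; rewrite mulr1.
by rewrite -e1; apply: eq_Rintegral => t _; rewrite mulr1.
Qed.

(** * Trigonometric integrals against the standard Gaussian density *)

Section gaussian_integrals.
Context {R : realType}.
Local Notation mu := (@lebesgue_measure R).
Local Notation gauss := (@normal_pdf R 0 1).

Lemma gaussE (x : R) : gauss x = normal_peak 1 * expR (- (x ^+ 2 / 2)).
Proof.
by rewrite normal_pdfE ?oner_neq0// /normal_fun subr0 expr1n mulNr.
Qed.

Lemma is_derive_gauss (x : R) : is_derive x 1 gauss (- (x * gauss x)).
Proof.
have -> : (gauss : R -> R) = (fun z => normal_peak 1 * expR (- (2^-1 * (z * z)))).
  by apply/funext => z; rewrite gaussE [_ / 2]mulrC.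
have d : is_derive x 1 (fun z : R => - (2^-1 * (z * z))) (- x).
  by apply: is_derive_eq; rewrite /GRing.scale /=; lra.
apply: is_derive_eq; rewrite /GRing.scale /=; ring.
Qed.

(** The first factor covers integrands of quadratic growth, the last is the decay asked by
    [rint_decay]. As [exp(x^2/2) >= 1 + x^4/8], the Gaussian absorbs the resulting polynomial of
    degree 4; the constant 40 is generous. *)
Lemma gauss_decay : exists C : R, forall x : R, (1 + `|x| + x ^+ 2) * gauss x * (1 + x ^+ 2) <= C.
Proof.
exists (40 * normal_peak 1) => x.
have e8 : expR (- (x ^+ 2 / 2)) * (1 + x ^+ 4 / 8) <= 1.
  rewrite -ler_pdivlMl ?expR_gt0// mulr1 -expRN opprK.
  have := @expR_ge1Dxn R (x ^+ 2 / 2) 1; rewrite divr_ge0 ?sqr_ge0// => /(_ isT).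
  by apply: le_trans; rewrite lerD2l (_ : 2`! = 2)%N// expr_div_n -exprM; lra.
have p0 := @normal_peak_ge0 R 1.
rewrite gaussE.
have : (1 + `|x| + x ^+ 2) * (1 + x ^+ 2) <= 40 * (1 + x ^+ 4 / 8).
  have <- : `|x| ^+ 2 = x ^+ 2 by rewrite -normrX ger0_norm// sqr_ge0.
  have <- : `|x| ^+ 4 = x ^+ 4 by rewrite -normrX ger0_norm// (exprM x 2 2) sqr_ge0.
  set a := `|x|; have a0 : 0 <= a by exact: normr_ge0.
  have := sqr_ge0 (a - 1); have := sqr_ge0 (a ^+ 2 - a); have := sqr_ge0 (a ^+ 2 - 1).
  lra.
move=> h; have e0 := expR_ge0 (- (x ^+ 2 / 2)).
rewrite (_ : _ * _ * _ = normal_peak 1 * expR (- (x ^+ 2 / 2)) *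
  ((1 + `|x| + x ^+ 2) * (1 + x ^+ 2))); last by ring.
rewrite [leRHS]mulrC -mulrA ler_wpM2l//.
apply: le_trans (ler_wpM2l e0 h) _.
by rewrite mulrCA -[leRHS]mulr1 ler_wpM2l.
Qed.

Let gauss0 x : 0 <= gauss x. Proof. exact: normal_pdf_ge0. Qed.

Let mgauss : measurable_fun setT gauss.
Proof. exact: measurable_normal_pdf. Qed.

Lemma rint_gauss (f : R -> R) : measurable_fun setT f ->
  (forall x, `|f x| <= 1 + `|x| + x ^+ 2) -> rint mu (fun x => f x * gauss x).
Proof.
move=> mf fb; have [C hC] := gauss_decay.
apply: (@rint_decay _ _ C) => [|x]; first exact: measurable_funM.
apply: le_trans (hC x); rewrite ler_wpM2r ?addr_ge0 ?sqr_ge0//.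
by rewrite normrM (ger0_norm (gauss0 x)) ler_wpM2r.
Qed.

Lemma Rintegral_gauss : \int[mu]_x gauss x = 1.
Proof. by rewrite /Rintegral integral_normal_pdf. Qed.

Let msin := @measurable_sinM R.

Let mcos := @measurable_cosM R.

Let sin_bounded := @normr_sin_le1 R.

Let cos_bounded := @normr_cos_le1 R.

Let weight1 (x : R) : 1 <= 1 + `|x| + x ^+ 2.
Proof. by have := normr_ge0 x; have := sqr_ge0 x; lra. Qed.

Let weightx (x : R) : `|x| <= 1 + `|x| + x ^+ 2.
Proof. by have := sqr_ge0 x; lra. Qed.

Lemma rint_gauss1 (f : R -> R) : measurable_fun setT f ->
  (forall x, `|f x| <= 1) -> rint mu (fun x => f x * gauss x).
Proof. by move=> mf f1; apply: rint_gauss => // x; exact: le_trans (f1 x) _. Qed.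

Lemma rint_gaussx (f : R -> R) : measurable_fun setT f ->
  (forall x, `|f x| <= 1) -> rint mu (fun x => x * f x * gauss x).
Proof.
move=> mf f1; apply: rint_gauss => [|x]; first exact: measurable_funM.
by rewrite normrM; apply: le_trans (weightx x); rewrite ler_piMr.
Qed.

Let continuous_gauss : continuous gauss.
Proof. by apply: continuous_normal_pdf; exact: oner_neq0. Qed.

(** Stein's identity: [f gauss] has derivative [(f' - x f) gauss] and vanishes at infinity. *)
Let stein (f f' : R -> R) (B : R) : (forall x : R, is_derive x 1 f (f' x)) ->
  continuous f' -> (forall x, `|f x| <= 1) -> (forall x, `|f' x| <= B) ->
  \int[mu]_x (x * f x * gauss x) = \int[mu]_x (f' x * gauss x).
Proof.
move=> df cf' f1 f'B.
have cf : continuous f.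
  by move=> x; apply: differentiable_continuous; apply/derivable1_diffP; have := df x => h; exact: ex_derive.
have mf := continuous_measurable_fun cf.
have mf' := continuous_measurable_fun cf'.
have i1 := rint_gaussx mf f1.
have i2 : rint mu (fun x => f' x * gauss x).
  have := rintM_bounded (rint_gauss1 (f := cst 1) _ _) mf' f'B.
  move=> H; rewrite (_ : EFin \o _ = EFin \o (fun x => cst 1 x * gauss x * f' x)).
    by apply: H => [|x]; rewrite ?normr1.
  by apply/funext => x /=; rewrite mul1r mulrC.
have [C hC] := gauss_decay.
apply/eqP; rewrite eq_sym -subr_eq0 -RintegralB//; apply/eqP.
apply: (@Rintegral_derive_eq0 _ (fun x => f x * gauss x) _ C).
- move=> x; have d1 := df x; have d2 := is_derive_gauss x.
  by apply: is_derive_eq; rewrite /GRing.scale /=; ring.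
- move=> x; apply: cvgB; first by apply: cvgM; [exact: cf'|exact: continuous_gauss].
  by apply: cvgM; [apply: cvgM; [exact: cvg_id|exact: cf]|exact: continuous_gauss].
- exact: rintB.
- move=> x; apply: le_trans (hC x).
  rewrite normrM (ger0_norm (gauss0 x)).
  have h1 : `|f x| * gauss x <= gauss x by rewrite ler_piMl.
  apply: (le_trans (ler_wpM2r _ h1)); first by rewrite addr_ge0.
  rewrite -mulrA [leRHS]mulrCA ler_wpM2l//.
  have := sqr_ge0 x; have := normr_ge0 x => a0 a1.
  have : 0 <= (1 + `|x| + x ^+ 2) * x ^+ 2 by rewrite mulr_ge0// addr_ge0// addr_ge0.
  lra.
Qed.

Let is_derive_sin b (x : R) : is_derive x 1 (fun z : R => sin (b * z)) (b * cos (b * x)).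
Proof. by apply: is_derive_eq; rewrite /GRing.scale /=; ring. Qed.

Let is_derive_cos b (x : R) : is_derive x 1 (fun z : R => cos (b * z)) (- b * sin (b * x)).
Proof. by apply: is_derive_eq; rewrite /GRing.scale /=; ring. Qed.

Let gcos (b : R) := \int[mu]_x (cos (b * x) * gauss x).
Let gsin (b : R) := \int[mu]_x (sin (b * x) * gauss x).

Let gauss_xsin0 b : \int[mu]_x (x * sin (b * x) * gauss x) = b * gcos b.
Proof.
rewrite (stein (B := `|b|) (is_derive_sin b))//.
- rewrite /gcos -RintegralZl//; last exact: rint_gauss1.
  by apply: eq_Rintegral => x _; rewrite mulrA.
- move=> x; apply: cvgMr.
  by apply: (@continuous_comp _ _ _ ( *%R b) cos); [exact: mulrl_continuous|exact: continuous_cos].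
- by move=> x; rewrite normrM ler_piMr.
Qed.

Let gauss_xcos0 b : \int[mu]_x (x * cos (b * x) * gauss x) = - b * gsin b.
Proof.
rewrite (stein (B := `|b|) (is_derive_cos b))//.
- rewrite /gsin -RintegralZl//; last exact: rint_gauss1.
  by apply: eq_Rintegral => x _; rewrite mulrA.
- move=> x; apply: cvgMr.
  by apply: (@continuous_comp _ _ _ ( *%R b) sin); [exact: mulrl_continuous|exact: continuous_sin].
- by move=> x; rewrite normrM normrN ler_piMr.
Qed.

(** The majorant [|x| gauss x] of the derivative does not depend on the parameter, so any
    neighbourhood of [b] serves; the one of radius 1 is taken. *)
Let diff_under (h h' : R -> R -> R) (b : R) :
  (forall b x : R, is_derive b 1 (h ^~ x) (h' b x)) ->
  (forall b, rint mu (h b)) -> (forall b x, `|h' b x| <= `|x| * gauss x) ->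
  is_derive b 1 (fun b => \int[mu]_x h b x) (\int[mu]_x h' b x).
Proof.
move=> dh ih bh.
have iG : rint mu (fun x => `|x| * gauss x).
  by apply: rint_gauss => [|x]; [exact: normr_measurable|rewrite normr_id].
have bI : `](b - 1), (b + 1)[%classic b by rewrite /= in_itv /=; lra.
have der1 (y x : R) : derivable (h ^~ x) y 1 by have := dh y x => H; exact: ex_derive.
have dE y x : partial1of2 h y x = h' y x.
  by rewrite partial1of2E; have := dh y x => H; exact: derive_val.
have G0 (y : R) : 0 <= `|y| * gauss y by rewrite mulr_ge0.
have D := @derivable_under_integral _ _ _ mu h setT measurableT b _ _ bI
  (fun y _ => ih y) (fun y x _ _ => der1 y x) _ G0 iG.
have E := @differentiation_under_integral _ _ _ mu h setT measurableT b _ _ bI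
  (fun y _ => ih y) (fun y x _ _ => der1 y x) _ G0 iG.
have bd y x : `](b - 1), (b + 1)[%classic y -> setT x ->
  `|partial1of2 h y x| <= `|x| * gauss x by rewrite dE.
apply: DeriveDef; first exact: D bd.
rewrite -derive1E (E bd); apply: eq_Rintegral => x _; exact: dE.
Qed.

Let is_derive_gcos (b : R) : is_derive b 1 gcos (- b * gcos b).
Proof.
rewrite /gcos (_ : - b * _ = \int[mu]_x (- (x * sin (b * x) * gauss x))).
  apply: (@diff_under (fun b x => cos (b * x) * gauss x)
    (fun b x => - (x * sin (b * x) * gauss x))) => [c x|c|c x].
  - by apply: is_derive_eq; rewrite /GRing.scale /=; ring.
  - exact: rint_gauss1.
  - by rewrite normrN !normrM (ger0_norm (gauss0 x)) ler_wpM2r// ler_piMr.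
rewrite mulNr -gauss_xsin0 -mulN1r -RintegralZl//; last exact: rint_gaussx.
by apply: eq_Rintegral => x _; rewrite mulN1r.
Qed.

Let is_derive_gsin (b : R) : is_derive b 1 gsin (- b * gsin b).
Proof.
rewrite -gauss_xcos0.
apply: (@diff_under (fun b x => sin (b * x) * gauss x)
    (fun b x => x * cos (b * x) * gauss x)) => [c x|c|c x].
- by apply: is_derive_eq; rewrite /GRing.scale /=; ring.
- exact: rint_gauss1.
- by rewrite !normrM (ger0_norm (gauss0 x)) ler_wpM2r// ler_piMr.
Qed.

(** [f(b) exp(b^2/2)] has zero derivative. Both [gcos] and [gsin] solve this equation:
    differentiating under the integral brings down a factor [x], which Stein's identity turns into a
    factor [b]. *)
Let gauss_ode (f : R -> R) : (forall b : R, is_derive b 1 f (- b * f b)) ->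
  forall b, f b = f 0 * expR (- (b ^+ 2 / 2)).
Proof.
move=> df b; pose h z := f z * expR (2^-1 * (z * z)).
have dh (z : R) : is_derive z 1 h 0.
  by have d := df z; apply: is_derive_eq; rewrite /GRing.scale /=; field.
have hc : h b = h 0 by apply: (@is_derive_0_is_cst _ h).
move: hc; rewrite /h !mulr0 expR0 mulr1 => <-.
by rewrite -mulrA -expRD (_ : _ + _ = 0) ?expR0 ?mulr1//; field.
Qed.

Lemma gauss_cos b : \int[mu]_x (cos (b * x) * gauss x) = expR (- (b ^+ 2 / 2)).
Proof.
rewrite -/(gcos b) (gauss_ode is_derive_gcos) (_ : gcos 0 = 1) ?mul1r//.
rewrite -Rintegral_gauss; apply: eq_Rintegral => x _.
by rewrite mul0r cos0 mul1r.
Qed.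

Lemma gauss_sin b : \int[mu]_x (sin (b * x) * gauss x) = 0.
Proof.
rewrite -/(gsin b) (gauss_ode is_derive_gsin) (_ : gsin 0 = 0) ?mul0r//.
rewrite /gsin; under eq_Rintegral do rewrite mul0r sin0 mul0r.
by rewrite /Rintegral integral0.
Qed.

Lemma gauss_xsin b :
  \int[mu]_x (x * sin (b * x) * gauss x) = b * expR (- (b ^+ 2 / 2)).
Proof. by rewrite gauss_xsin0 /gcos gauss_cos. Qed.

Lemma gauss_xcos b : \int[mu]_x (x * cos (b * x) * gauss x) = 0.
Proof. by rewrite gauss_xcos0 /gsin gauss_sin mulr0. Qed.

End gaussian_integrals.

Lemma quant_error_series d (T : measurableType d) (R : realType)
    (P : probability T R) (X Y : T -> R) (delta C : R) :
  rint P X -> measurable_fun setT Y -> 0 < delta ->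
  (forall n, `|sin_coef P X Y delta n.+1 / n.+1%:R| <= C / n.+1%:R ^+ 2) ->
  cos_coef P X Y delta n @[n --> \oo] --> (0 : R) ->
  rint P (fun t => X t * (Y t - quant delta (Y t))) /\
  delta / pi * \sum_(n < N) (-1) ^+ n * (sin_coef P X Y delta n.+1 / n.+1%:R)
    @[N --> \oo] --> \int[P]_t (X t * (Y t - quant delta (Y t))).
Proof.
move=> iX mY d0 hC c0.
have C0 : 0 <= C by have := le_trans (normr_ge0 _) (hC 0); rewrite expr1n divr1.
(* With [a = n + 1] the decrement is [2 C / (a (a + 1))], which is at least [C / a^2] because
   [a >= 1]. *)
pose w n : R := 2 * C * n.+1%:R^-1.
have cw : w n @[n --> \oo] --> (0 : R).
  by rewrite -[X in _ --> X](mulr0 (2 * C)); apply: cvgMr; exact: cvg_harmonic.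
have hw n : `|sin_coef P X Y delta n.+1 / n.+1%:R| <= w n - w n.+1.
  apply: le_trans (hC n) _.
  have n1 : 0 < n.+1%:R :> R by [].
  have n2 : n.+2%:R = n.+1%:R + 1 :> R by rewrite natr1.
  have n1' : 1 <= n.+1%:R :> R by rewrite ler1n.
  rewrite /w n2; move: n1 n1'; set a := n.+1%:R => a0 a1.
  rewrite -subr_ge0 (_ : _ - _ = C * (a - 1) / (a ^+ 2 * (a + 1))); last first.
    by field; rewrite !gt_eqF// addr_gt0.
  by rewrite divr_ge0 ?mulr_ge0 ?exprn_ge0 ?subr_ge0// ?addr_ge0 ?ltW// addr_ge0.
split; first exact: (rint_quant_error iX mY d0).
exact: (@cvg_quant_error _ T R P X Y delta iX mY d0 w cw hw c0).
Qed.

(** * Coefficients of a standard Gaussian entry *)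

Section gaussian_entries.
Context d (T : measurableType d) (R : realType) (P : probability T R).
Variable X : {RV P >-> R}.
Hypothesis gX : standard_gaussian X.
Local Notation mu := (@lebesgue_measure R).
Local Notation gauss := (@normal_pdf R 0 1).

Let dX : has_density X gauss.
Proof.
split; [exact: measurable_normal_pdf|exact: normal_pdf_ge0|].
by move=> A mA; rewrite gX.
Qed.

Let mcos := @measurable_cosM R.

Let msin := @measurable_sinM R.

Let sin_bounded := @normr_sin_le1 R.

Let cos_bounded := @normr_cos_le1 R.

Lemma rint_gaussian : rint P X.
Proof.
have [] // := density_transfer (f := fun y => y) dX.
have -> : (fun t : R => t * gauss t) = (fun t => t * cst 1 t * gauss t).
  by apply/funext => t; rewrite mulr1.
by apply: rint_gaussx => // x; rewrite normr1.
Qed.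

Lemma Cint_gaussian b :
  Cint P (fun t => expi (- (b * X t))) = Complex (expR (- (b ^+ 2 / 2))) 0.
Proof.
have [_ e1] := density_transfer dX (mcos b) (rint_gauss1 (mcos b) (fun x => cos_bounded _)).
have [i2 e2] := density_transfer dX (msin b) (rint_gauss1 (msin b) (fun x => sin_bounded _)).
congr Complex.
  by under eq_Rintegral do rewrite /= cosN; rewrite e1 gauss_cos.
under eq_Rintegral do rewrite /= sinN -mulN1r.
by rewrite RintegralZl// e2 gauss_sin mulr0.
Qed.

Lemma Cint_gaussianM b :
  Cint P (fun t => Complex (X t) 0 * expi (- (b * X t))) =
  Complex 0 (- (b * expR (- (b ^+ 2 / 2)))).
Proof.
have mxcos : measurable_fun setT (fun y : R => y * cos (b * y)) by exact: measurable_funM.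
have mxsin : measurable_fun setT (fun y : R => y * sin (b * y)) by exact: measurable_funM.
have [_ e1] := density_transfer dX mxcos (rint_gaussx (mcos b) (fun x => cos_bounded _)).
have [i2 e2] := density_transfer dX mxsin (rint_gaussx (msin b) (fun x => sin_bounded _)).
congr Complex.
  by under eq_Rintegral do rewrite ReM /= cosN mul0r subr0; rewrite e1 gauss_xcos.
under eq_Rintegral do rewrite ImM /= sinN mul0r addr0 mulrN -mulN1r.
by rewrite RintegralZl// e2 gauss_xsin mulN1r.
Qed.

End gaussian_entries.

Lemma prod_Complex (R : rcfType) (I : Type) (r : seq I) (Q : pred I) (u : I -> R) :
  \prod_(i <- r | Q i) Complex (u i) 0 = Complex (\prod_(i <- r | Q i) u i) 0.
Proof.
elim: r => [|i r IH]; first by rewrite !big_nil.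
rewrite !big_cons; case: ifP => // _; rewrite IH.
by apply/eqP; rewrite eq_complex ReM ImM /=; apply/andP; split; apply/eqP; ring.
Qed.

Lemma enorm_sqr (R : realType) n (u : 'cV[R]_n) : enorm u ^+ 2 = \sum_i u i 0 ^+ 2.
Proof. by rewrite sqr_sqrtr// sumr_ge0// => i _; exact: sqr_ge0. Qed.

Lemma enorm_eq0 (R : realType) n (u : 'cV[R]_n) : (enorm u == 0) = (u == 0).
Proof.
rewrite -sqrf_eq0 enorm_sqr psumr_eq0 => [|i _]; last exact: sqr_ge0.
apply/allP/eqP => [h|-> i _]; last by rewrite mxE expr0n /= eqxx.
apply/matrixP => i j; rewrite (ord1 j) mxE; apply/eqP.
by rewrite -sqrf_eq0; exact: (h i (mem_index_enum i)).
Qed.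

Lemma enormZ (R : realType) n (a : R) (u v : 'cV[R]_n) : 0 <= a ->
  (forall i, v i 0 = a * u i 0) -> enorm v = a * enorm u.
Proof.
move=> a0 h; rewrite /enorm -(ger0_norm a0) -sqrtr_sqr -sqrtrM ?sqr_ge0// mulr_sumr.
by congr Num.sqrt; apply: eq_bigr => i _; rewrite h exprMn.
Qed.

(** * Alternating sums with decreasing terms *)

Section alternating_sums.
Context {R : realType}.
Variable u : nat -> R.
Hypotheses (u_ge0 : forall n, 0 <= u n) (u_dec : forall n, u n.+1 <= u n).

Let altS N k : \sum_(n < N.+1) (-1) ^+ n * u (k + n)%N =
  u k - \sum_(n < N) (-1) ^+ n * u (k.+1 + n)%N.
Proof.
rewrite big_ord_recl /= expr0 mul1r addn0; congr (_ + _).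
rewrite -sumrN; apply: eq_bigr => n _.
by rewrite /bump /= add1n exprS addSnnS; ring.
Qed.

Let alt_bounds N : forall k, 0 <= \sum_(n < N) (-1) ^+ n * u (k + n)%N <= u k.
Proof.
elim: N => [k|N IH k]; first by rewrite big_ord0 lexx u_ge0.
by rewrite altS; have := IH k.+1; have := u_dec k; lra.
Qed.

(** A limit preserves only non-strict inequalities. The extra terms [u 2 - u 3] below and
    [u 1 - u 2] above are the slack that makes the bounds on the limit strict. *)
Lemma alt_sum_bounds N :
  u 0 - u 1 + (u 2 - u 3) <= \sum_(n < N.+4) (-1) ^+ n * u n <= u 0 - (u 1 - u 2).
Proof.
rewrite (altS N.+3 0) !altS.
by have := alt_bounds N 4; have := u_dec 3; have := u_dec 2; lra.
Qed.

End alternating_sums.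

(** * Gaussian matrices: the series and the bounds on its norm *)

Section gaussian_matrix.
Context d (T : measurableType d) (R : realType) (P : probability T R).
Context (m k : nat) (e : 'I_m -> 'I_k -> {RV P >-> R}).
Hypothesis hind : mutually_independent (fun ij : 'I_m * 'I_k => e ij.1 ij.2).
Variables (delta : R) (x : 'cV[R]_k).
Hypothesis delta_gt0 : 0 < delta.
Hypothesis he : forall i j, standard_gaussian (e i j).
Hypothesis hm : exists l : 'I_m, True.

Let c : R := 2 * pi ^+ 2 * enorm x ^+ 2 / delta ^+ 2.
Let q n : R := expR (- (c * n%:R ^+ 2)).
Let S N : R := \sum_(n < N) (-1) ^+ n * q n.+1.

(** The factor of column [i] is purely imaginary and the others are real, so the cosine coefficient
    vanishes. The exponentials of all columns multiply to [q n], since the squared coordinates of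
    [x] add up to its squared norm. *)
Let coefs l i n : cos_coef P (e l i) (measurement e x l) delta n = 0 /\
  sin_coef P (e l i) (measurement e x l) delta n = 2 * pi * n%:R * x i 0 / delta * q n.
Proof.
have := row_coef hind delta x n (rint_gaussian (he l i)).
rewrite Cint_gaussianM//; under eq_bigr do rewrite Cint_gaussian//.
rewrite prod_Complex => E.
have E1 := congr1 (@complex.Re R) E; have E2 := congr1 (@complex.Im R) E.
rewrite ReM /= in E1; rewrite ImM /= in E2.
split; first by rewrite E1; ring.
apply: oppr_inj; rewrite E2 mul0r add0r mulNr.
rewrite -(mulrA (2 * pi * n%:R * x i 0 / delta)); congr (- (_ * _)).
pose b s := 2 * pi * n%:R * x s 0 / delta.
have -> : expR (- (b i ^+ 2 / 2)) * \prod_(s < k | s != i) expR (- (b s ^+ 2 / 2)) =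
    \prod_(s < k) expR (- (b s ^+ 2 / 2)) by rewrite [RHS](bigD1 i).
rewrite -expR_sum /q /c enorm_sqr; congr expR.
rewrite sumrN; congr (- _); rewrite !mulr_sumr !mulr_suml.
by apply: eq_bigr => s _; rewrite /b; field; rewrite gt_eqF.
Qed.

Let term l i n : sin_coef P (e l i) (measurement e x l) delta n.+1 / n.+1%:R =
  2 * pi * x i 0 / delta * q n.+1.
Proof.
have [_ ->] := coefs l i n.+1.
by field; rewrite gt_eqF//= ?nat1r ?natr1 pnatr_eq0.
Qed.

Let c_gt0 : x != 0 -> 0 < c.
Proof.
move=> x0; have ex : 0 < enorm x by rewrite lt_neqAle eq_sym enorm_eq0 x0 sqrtr_ge0.
by rewrite /c divr_gt0 ?exprn_gt0// mulr_gt0 ?exprn_gt0// mulr_gt0 ?exprn_gt0 ?pi_gt0.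
Qed.

Let error_limit l i :
  rint P (fun t => e l i t * (measurement e x l t - quant delta (measurement e x l t))) /\
  2 * x i 0 * S N @[N --> \oo] -->
  \int[P]_t (e l i t * (measurement e x l t - quant delta (measurement e x l t))).
Proof.
(* The constant comes from [exp(-y) <= 1/y] at [y = c (n+1)^2]. For [x = 0] also [c = 0]; the
   constant is then 0, and so are the coefficients. *)
have [||h1 h2] := @quant_error_series _ T R P (e l i) (measurement e x l) delta
  (`|2 * pi * x i 0 / delta| / c) (rint_gaussian (he l i))
  (measurable_measurement e x l) delta_gt0.
- move=> n; rewrite term normrM [X in _ * X]ger0_norm ?expR_ge0// -mulrA.
  have [x0|/c_gt0 c0] := eqVneq x 0.
    by rewrite x0 mxE mul0r mulr0 normr0 !mul0r.
  have cn0 : 0 < c * n.+1%:R ^+ 2 by apply: mulr_gt0 => //; exact: exprn_gt0.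
  rewrite -[leRHS]mulrA ler_wpM2l// -invfM -[leRHS]mul1r ler_pdivlMr//.
  have h := expR_ge1Dx (c * n.+1%:R ^+ 2).
  rewrite /q expRN mulrC ler_pdivrMr ?expR_gt0// mul1r (le_trans _ h)// lerDr//.
- by under eq_fun do rewrite (coefs _ _ _).1; exact: cvg_cst.
split=> //; rewrite (_ : (fun N => 2 * x i 0 * S N) = (fun N => delta / pi *
    \sum_(n < N) (-1) ^+ n *
      (sin_coef P (e l i) (measurement e x l) delta n.+1 / n.+1%:R)))//.
apply/funext => N; rewrite /S !mulr_sumr; apply: eq_bigr => n _.
rewrite term; move: (@lt0r_neq0 _ _ (@pi_gt0 R)).
generalize (pi : R) => p p0; field; rewrite p0 /=.
by rewrite gt_eqF.
Qed.

Let q_gt0 n : 0 < q n. Proof. exact: expR_gt0. Qed.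

Let q_dec n : x != 0 -> q n.+1 < q n.
Proof.
move=> /c_gt0 c0; rewrite /q ltr_expR ltrN2 ltr_pM2l//.
by rewrite ltr_sqr ?nnegrE// ltr_nat.
Qed.

(** Convergence is read off [error_limit] in any row, at a coordinate with [x_i != 0], by dividing
    by [2 x_i]. *)
Let S_cvg : x != 0 -> cvgn S.
Proof.
move=> x0; have [i xi] : exists i, x i 0 != 0.
  apply/existsP; apply: contraNT x0; rewrite negb_exists => /forallP h.
  by apply/eqP/matrixP => i j; rewrite (ord1 j) mxE; have := h i; rewrite negbK => /eqP.
have [l _] : exists l : 'I_m, True by exact: hm.
have [_ h] := error_limit l i.
apply/cvg_ex; eexists.
have -> : S = (fun N => (2 * x i 0)^-1 * (2 * x i 0 * S N)).
  by apply/funext => N; rewrite mulKf// mulf_neq0.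
by apply: cvgM; [exact: cvg_cst|exact: h].
Qed.

Let S_bounds : x != 0 -> q 1 - q 2 < limn S < q 1.
Proof.
move=> x0; have Sc := S_cvg x0.
have u0 n : 0 <= q n.+1 by exact: ltW.
have ud n : q n.+2 <= q n.+1 by apply/ltW/q_dec.
have h n := @alt_sum_bounds R (fun n => q n.+1) u0 ud n.
have h1 := q_dec 2 x0; have h2 := q_dec 3 x0.
have lo : q 1 - q 2 + (q 3 - q 4) <= limn S.
  apply: limr_ge => //; near=> n.
  have n4 : (4 <= n)%N by near: n; exact: nbhs_infty_ge.
  by rewrite -(subnK n4) addn4; have /andP[] := h (n - 4)%N.
have hi : limn S <= q 1 - (q 2 - q 3).
  apply: limr_le => //; near=> n.
  have n4 : (4 <= n)%N by near: n; exact: nbhs_infty_ge.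
  by rewrite -(subnK n4) addn4; have /andP[] := h (n - 4)%N.
by apply/andP; split; lra.
Unshelve. all: by end_near. Qed.

Let EV := expectation_vec P (fun t => residual delta x (random_matrix e t)).
Let a p : R := (-1) ^+ p *
  expR (- (2 * pi ^+ 2 * enorm x ^+ 2 * p%:R ^+ 2 / delta ^+ 2)).

Let a_sum : (fun n => \sum_(1 <= p < n.+1) a p) = - S.
Proof.
apply/funext => n; rewrite big_add1 /= big_mkord -[RHS]sumrN.
apply: eq_bigr => i _; rewrite /a /q exprS mulN1r mulNr.
by congr (- (_ * expR (- _))); rewrite /c; field; rewrite gt_eqF.
Qed.

Lemma gaussian_matrix_integrable :
  integrable_vec P (fun t => residual delta x (random_matrix e t)).
Proof. by apply: integrable_residual => l i; have [] := error_limit l i. Qed.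

Let a_cvg : x != 0 -> \sum_(1 <= p < n) a p @[n --> \oo] --> - limn S.
Proof.
move=> x0; have h : - S @ \oo --> - limn S by apply: cvgN; exact: S_cvg.
by rewrite -a_sum in h; rewrite -cvg_shiftS.
Qed.

Lemma gaussian_series_cvg : x != 0 -> cvgn (fun n => \sum_(1 <= p < n) a p).
Proof. by move=> x0; apply/cvg_ex; exists (- limn S); exact: a_cvg. Qed.

Let limn_a : x != 0 -> limn (fun n => \sum_(1 <= p < n) a p) = - limn S.
Proof. by move=> x0; apply/cvg_lim => //; exact: a_cvg. Qed.

Lemma gaussian_expectation i :
  EV i 0 = - 2 * m%:R * x i 0 * limn (fun n => \sum_(1 <= p < n) a p).
Proof.
rewrite /EV (@expectation_residual _ _ _ _ _ _ e delta x (fun i => 2 * x i 0 * limn S)).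
(* For [x = 0] the terms are [(-1)^p], the partial sums oscillate and [limn] is an unspecified
   value, which the factor [x_i = 0] removes. *)
- have [x0|x0] := eqVneq x 0; first by rewrite x0 mxE !(mulr0, mul0r).
  by rewrite limn_a//; ring.
- by move=> l j; have [] := error_limit l j.
- move=> l j; have [_ h] := error_limit l j.
  have [x0|x0] := eqVneq (x j 0) 0.
    have E0 : (fun N => 2 * x j 0 * S N) = cst 0.
      by apply/funext => N; rewrite x0 mulr0 mul0r.
    rewrite E0 in h; rewrite x0 mulr0 mul0r.
    have h0 : cst (0 : R) n @[n --> \oo] --> (0 : R) by exact: cvg_cst.
    exact: (cvg_unique _ h h0).
  have h0 : 2 * x j 0 * S N @[N --> \oo] --> 2 * x j 0 * limn S.
    apply: cvgM; [exact: cvg_cst|apply: S_cvg].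
    by apply: contraNneq x0 => ->; rewrite mxE.
  exact: (cvg_unique _ h h0).
Qed.

(** The expectation is the vector [x] times the nonnegative scalar [2 m lim S], so [mu] is [2 lim S]
    times the norm of [x]. The two exponentials are [q 1] and [q 2], whence the 8 as [2 * 2^2]. *)
Lemma gaussian_mu_bounds : x != 0 ->
  2 * enorm x *
    (expR (- (2 * pi ^+ 2 * enorm x ^+ 2 / delta ^+ 2)) -
     expR (- (8 * pi ^+ 2 * enorm x ^+ 2 / delta ^+ 2))) < m%:R^-1 * enorm EV /\
  m%:R^-1 * enorm EV < 2 * enorm x *
    expR (- (2 * pi ^+ 2 * enorm x ^+ 2 / delta ^+ 2)).
Proof.
move=> x0; have /andP[b1 b2] := S_bounds x0.
have ex : 0 < enorm x by rewrite lt_neqAle eq_sym enorm_eq0 x0 sqrtr_ge0.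
have m0 : m%:R != 0 :> R by have [l _] := hm; rewrite pnatr_eq0 -lt0n (leq_ltn_trans _ (ltn_ord l)).
have q12 := q_dec 1 x0.
have S0 : 0 < limn S by lra.
have -> : m%:R^-1 * enorm EV = 2 * enorm x * limn S.
  rewrite (@enormZ _ _ (2 * m%:R * limn S) x); last first.
  - by move=> i; rewrite gaussian_expectation limn_a//; ring.
  - by rewrite !mulr_ge0// ltW.
  by field.
have -> : expR (- (2 * pi ^+ 2 * enorm x ^+ 2 / delta ^+ 2)) = q 1.
  by rewrite /q /c expr1n mulr1.
have -> : expR (- (8 * pi ^+ 2 * enorm x ^+ 2 / delta ^+ 2)) = q 2.
  by rewrite /q /c; congr (expR (- _)); field; rewrite gt_eqF.
by rewrite !ltr_pM2l ?mulr_gt0.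
Qed.

End gaussian_matrix.

(** * Schwartz densities and the function [g] *)

Section schwartz_density.
Context {R : realType}.
Local Notation mu := (@lebesgue_measure R).
Variable phi : R -> R.
Hypothesis sphi : schwartz phi.

Let phi1 := derive1n 1 phi.

Lemma is_derive_schwartz (t : R) : is_derive t 1 phi (phi1 t).
Proof. by apply: DeriveDef; [exact: (sphi.1 0)|rewrite /phi1 /= derive1E]. Qed.

Lemma continuous_schwartz n : continuous (derive1n n phi).
Proof.
move=> t; apply: differentiable_continuous; apply/derivable1_diffP.
exact: sphi.1.
Qed.

(** The weight [1 + t^2] costs two more powers of [t], hence the sum of the bounds for the powers
    [j] and [j + 2]. *)
Lemma schwartz_decay j n :
  exists C, forall t, `|t ^+ j * derive1n n phi t| * (1 + t ^+ 2) <= C.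
Proof.
have [M1 h1] := sphi.2 j n; have [M2 h2] := sphi.2 j.+2 n.
exists (M1 + M2) => t; rewrite mulrDr mulr1 lerD ?h1//.
apply: le_trans (h2 t); rewrite -[X in _ * X](ger0_norm (sqr_ge0 t)) -normrM.
by rewrite mulrAC -exprD addn2.
Qed.

Lemma rint_schwartz j n : rint mu (fun t => t ^+ j * derive1n n phi t).
Proof.
have [C hC] := schwartz_decay j n.
apply: (rint_decay _ hC); apply: continuous_measurable_fun => t.
by apply: cvgM; [exact: exprn_continuous|exact: continuous_schwartz].
Qed.

Let ixphi : rint mu (fun t => t * phi t).
Proof. exact: (rint_schwartz 1 0). Qed.

Let cphi : continuous phi. Proof. exact: (@continuous_schwartz 0). Qed.

Let cxphi : continuous (fun t : R => t * phi t).
Proof. by move=> t; apply: cvgM; [exact: cvg_id|exact: cphi]. Qed.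

Let mxphi : measurable_fun setT (fun t : R => t * phi t).
Proof. exact: continuous_measurable_fun. Qed.

Definition partial_mean (z : R) : R := \int[mu]_(t in `]-oo, z]) (t * phi t).

Let g := partial_mean.

Lemma is_derive_partial_mean (z : R) : is_derive z 1 g (z * phi z).
Proof.
have z1 : z < z + 1 by rewrite ltrDl.
have iz : mu.-integrable `]-oo, (z + 1)] (EFin \o (fun t => t * phi t)).
  by apply: (integrableS measurableT) ixphi => //; exact: measurable_itv.
have [|h1 h2] := @continuous_FTC1 R (fun t => t * phi t) -oo%O z (z + 1) z1 iz _ (@cxphi z).
  by rewrite /= ltNyr.
by apply: DeriveDef => //; rewrite -derive1E.
Qed.

Lemma continuous_partial_mean : continuous g.
Proof.
move=> z; apply: differentiable_continuous; apply/derivable1_diffP.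
by have h := is_derive_partial_mean z; exact: ex_derive.
Qed.

Hypothesis mean0 : \int[mu]_t (t * phi t) = 0.

Let gE z : g z = \int[mu]_t ((t <= z)%R%:R * (t * phi t)).
Proof.
rewrite /g /partial_mean Rintegral_mkcond; apply: eq_Rintegral => t _.
by rewrite patchE mem_setE in_itv /=; case: ifP; rewrite ?mul1r ?mul0r.
Qed.

Let iweight (Q : pred R) : measurable_fun setT (fun t : R => (Q t)%:R : R) ->
  rint mu (fun t => (Q t)%:R * (t * phi t)).
Proof.
move=> mQ; under eq_fun do rewrite mulrC.
apply: (rintM_bounded (B := 1) ixphi mQ) => t.
by case: (Q t); rewrite ?normr1 ?normr0.
Qed.

Let mle z : measurable_fun setT (fun t : R => (t <= z)%R%:R : R).
Proof.
rewrite (_ : (fun t => _) = \1_(`]-oo, z]%classic)); first exact: measurable_indic.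
by apply/funext => t; rewrite indicE mem_setE in_itv.
Qed.

Let mgt z : measurable_fun setT (fun t : R => (z < t)%R%:R : R).
Proof.
rewrite (_ : (fun t => _) = \1_(`]z, +oo[%classic)); first exact: measurable_indic.
by apply/funext => t; rewrite indicE mem_setE in_itv /= andbT.
Qed.

Let gE_gt z : g z = - \int[mu]_t ((z < t)%R%:R * (t * phi t)).
Proof.
apply/eqP; rewrite -addr_eq0 gE -RintegralD//.
- rewrite -[X in _ == X]mean0; apply/eqP; apply: eq_Rintegral => t _.
  by rewrite ltNge; case: (t <= z); rewrite /= ?mul1r ?mul0r ?addr0 ?add0r.
- exact: iweight.
- exact: iweight.
Qed.

(* Since the mean is 0, [g z] is up to sign an integral over a half-line on
   which [z^2 <= t^2]. *)
Lemma partial_mean_decay z :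
  `|g z| * (1 + z ^+ 2) <= \int[mu]_t (`|t * phi t| * (1 + t ^+ 2)).
Proof.
have iW : rint mu (fun t => `|t * phi t| * (1 + t ^+ 2)).
  have i3 := integrable_norm (rint_schwartz 3 0).
  have i1 := integrable_norm ixphi.
  rewrite (_ : EFin \o _ = EFin \o (fun t => `|t * phi t| + `|t ^+ 3 * phi t|)).
    exact: rintD.
  apply/funext => t /=; congr EFin; rewrite mulrDr mulr1; congr (_ + _).
  by rewrite -[X in _ * X](ger0_norm (sqr_ge0 t)) -normrM; congr `|_|; ring.
have key (Q : pred R) : measurable_fun setT (fun t : R => (Q t)%:R : R) ->
    (forall t, Q t -> z ^+ 2 <= t ^+ 2) ->
    `|\int[mu]_t ((Q t)%:R * (t * phi t))| * (1 + z ^+ 2) <=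
    \int[mu]_t (`|t * phi t| * (1 + t ^+ 2)).
  move=> mQ Qz; have iQ := iweight mQ.
  have z0 : 0 <= 1 + z ^+ 2 by rewrite addr_ge0// sqr_ge0.
  apply: (le_trans (ler_wpM2r z0 (le_normr_Rintegral measurableT iQ))).
  have iQ' := integrable_norm iQ.
  rewrite -RintegralZr//; apply: le_Rintegral => //.
    by under eq_fun do rewrite mulrC; exact: rintZ.
  move=> t _; rewrite normrM; case: (boolP (Q t)) => [Qt|_].
    by rewrite normr1 mul1r ler_wpM2l// lerD2l Qz.
  by rewrite normr0 !mul0r mulr_ge0// addr_ge0// sqr_ge0.
have [z0|z0] := leP z 0.
  rewrite gE; apply: key => // t tz.
  by rewrite -(sqrrN z) -(sqrrN t) ler_sqr ?nnegrE ?lerN2 ?oppr_ge0// (le_trans tz).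
rewrite gE_gt normrN; apply: key => // t /ltW zt.
by rewrite ler_sqr ?nnegrE// ?(le_trans _ zt)// ltW.
Qed.

Let Cg := \int[mu]_t (`|t * phi t| * (1 + t ^+ 2)).

Lemma rint_partial_mean : rint mu g.
Proof.
apply: (rint_decay _ partial_mean_decay).
exact: continuous_measurable_fun continuous_partial_mean.
Qed.

Let linear_weight (a : R) : 1 + `|a| <= 2 * (1 + a ^+ 2).
Proof.
rewrite -(ger0_norm (sqr_ge0 a)) normrX.
by have := sqr_ge0 (`|a| - 1); have := normr_ge0 a; rewrite !expr2; nra.
Qed.

Let msin := @measurable_sinM R.

Let mcos := @measurable_cosM R.

Let sin_bounded := @normr_sin_le1 R.

Let cos_bounded := @normr_cos_le1 R.

Let is_derive_sin b (x : R) : is_derive x 1 (fun z : R => sin (b * z)) (b * cos (b * x)).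
Proof. by apply: is_derive_eq; rewrite /GRing.scale /=; ring. Qed.

Let is_derive_cos b (x : R) : is_derive x 1 (fun z : R => cos (b * z)) (- b * sin (b * x)).
Proof. by apply: is_derive_eq; rewrite /GRing.scale /=; ring. Qed.

Let csin b : continuous (fun x : R => sin (b * x)).
Proof. by move=> x; have d := is_derive_sin b x; apply: differentiable_continuous; apply/derivable1_diffP; exact: ex_derive. Qed.

Let ccos b : continuous (fun x : R => cos (b * x)).
Proof. by move=> x; have d := is_derive_cos b x; apply: differentiable_continuous; apply/derivable1_diffP; exact: ex_derive. Qed.

(** No boundary term survives, as [f] is bounded and [h] decays quadratically. It is applied with
    [h = g], [h' = x phi], and again with [h = x phi]. *)
Let trig_ibp (f f' h h' : R -> R) (B C : R) :
  (forall x : R, is_derive x 1 f (f' x)) -> continuous f' ->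
  (forall x, `|f x| <= 1) -> (forall x, `|f' x| <= B) ->
  (forall x : R, is_derive x 1 h (h' x)) -> continuous h' ->
  rint mu h -> rint mu h' -> (forall x, `|h x| * (1 + x ^+ 2) <= C) ->
  \int[mu]_x (f x * h' x) = - \int[mu]_x (f' x * h x).
Proof.
move=> df cf' f1 f'B dh ch' ih ih' hC.
have cf : continuous f.
  by move=> x; apply: differentiable_continuous; apply/derivable1_diffP; have := df x => H; exact: ex_derive.
have ch : continuous h.
  by move=> x; apply: differentiable_continuous; apply/derivable1_diffP; have := dh x => H; exact: ex_derive.
have i1 : rint mu (fun x => f x * h' x).
  under eq_fun do rewrite mulrC.
  exact: (rintM_bounded ih' (continuous_measurable_fun cf) f1).
have i2 : rint mu (fun x => f' x * h x).
  under eq_fun do rewrite mulrC.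
  exact: (rintM_bounded ih (continuous_measurable_fun cf') f'B).
apply/eqP; rewrite -addr_eq0 -RintegralD//; apply/eqP.
apply: (@Rintegral_derive_eq0 _ (fun x => f x * h x) _ (2 * C)).
- move=> x; have d1 := df x; have d2 := dh x.
  by apply: is_derive_eq; rewrite /GRing.scale /=; ring.
- move=> x; apply: cvgD; first by apply: cvgM; [exact: cf|exact: ch'].
  by apply: cvgM; [exact: cf'|exact: ch].
- exact: rintD.
- move=> x; have h0 := normr_ge0 (h x).
  have h1 : `|f x * h x| <= `|h x| by rewrite normrM ler_piMl.
  apply: (le_trans (ler_wpM2r _ h1)); first by rewrite addr_ge0.
  apply: (le_trans (ler_wpM2l h0 (linear_weight x))).
  by rewrite mulrCA ler_wpM2l.
Qed.

Let trig_scale (b : R) (f : R -> R) : measurable_fun setT f ->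
  (forall x, `|f x| <= 1) -> forall h, rint mu h ->
  \int[mu]_x (b * f x * h x) = b * \int[mu]_x (f x * h x).
Proof.
move=> mf f1 h ih; rewrite -RintegralZl//; first by apply: eq_Rintegral => x _; rewrite mulrA.
under eq_fun do rewrite mulrC.
exact: (rintM_bounded ih mf f1).
Qed.

Let bcos (b x : R) : `|b * cos (b * x)| <= `|b|.
Proof. by rewrite normrM ler_piMr. Qed.

Let bsin (b x : R) : `|- b * sin (b * x)| <= `|b|.
Proof. by rewrite normrM normrN ler_piMr. Qed.

Let cbcos b : continuous (fun x : R => b * cos (b * x)).
Proof. by move=> x; apply: cvgMr; exact: ccos. Qed.

Let cbsin b : continuous (fun x : R => - b * sin (b * x)).
Proof. by move=> x; apply: cvgMr; exact: csin. Qed.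

Lemma Rintegral_cos_mean b :
  \int[mu]_x (cos (b * x) * (x * phi x)) = b * \int[mu]_x (sin (b * x) * g x).
Proof.
rewrite (trig_ibp (is_derive_cos b) (@cbsin b) _ (bsin b) is_derive_partial_mean
  cxphi rint_partial_mean ixphi partial_mean_decay)//.
by rewrite trig_scale// ?mulNr ?opprK//; exact: rint_partial_mean.
Qed.

Lemma Rintegral_sin_mean b :
  \int[mu]_x (sin (b * x) * (x * phi x)) = - b * \int[mu]_x (cos (b * x) * g x).
Proof.
rewrite (trig_ibp (is_derive_sin b) (@cbcos b) _ (bcos b) is_derive_partial_mean
  cxphi rint_partial_mean ixphi partial_mean_decay)//.
by rewrite trig_scale// ?mulNr//; exact: rint_partial_mean.
Qed.

Let dxphi (x : R) : is_derive x 1 (fun t : R => t * phi t) (phi x + x * phi1 x).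
Proof.
have d := is_derive_schwartz x.
by apply: is_derive_eq; rewrite /GRing.scale /=; ring.
Qed.

Let cdxphi : continuous (fun x => phi x + x * phi1 x).
Proof.
move=> x; apply: cvgD; first exact: cphi.
by apply: cvgM; [exact: cvg_id|exact: (@continuous_schwartz 1)].
Qed.

Let idxphi : rint mu (fun x => phi x + x * phi1 x).
Proof.
apply: rintD; last exact: (rint_schwartz 1 1).
rewrite (_ : EFin \o phi = EFin \o (fun t => t ^+ 0 * derive1n 0 phi t)).
  exact: rint_schwartz.
by apply/funext => t /=; rewrite expr0 mul1r.
Qed.

Let K := \int[mu]_x `|phi x + x * phi1 x|.

Let Rintegral_trig_bounded (f h : R -> R) : measurable_fun setT f ->
  (forall x, `|f x| <= 1) -> rint mu h ->
  `|\int[mu]_x (f x * h x)| <= \int[mu]_x `|h x|.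
Proof.
move=> mf f1 ih.
have i1 : rint mu (fun x => f x * h x).
  by under eq_fun do rewrite mulrC; exact: (rintM_bounded ih mf f1).
apply: (le_trans (le_normr_Rintegral measurableT i1)).
apply: le_Rintegral => //; [exact: integrable_norm i1|exact: integrable_norm ih|].
by move=> x _; rewrite normrM ler_piMl.
Qed.

(** Integrating by parts twice turns [b^2] times the transform of [g] into a transform of
    [(x phi)'], up to sign. The constant is therefore the sum of the L1 norms of [g] and of
    [(x phi)']. This decay is what makes the bilateral series absolutely summable. *)
Lemma Rintegral_trig_decay : exists2 C : R, 0 <= C & forall b : R,
  `|\int[mu]_x (cos (b * x) * g x)| * (1 + b ^+ 2) <= C /\
  `|\int[mu]_x (sin (b * x) * g x)| * (1 + b ^+ 2) <= C.
Proof.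
have [D hD] := schwartz_decay 1 0.
have h0 : 0 <= \int[mu]_x `|g x| + K by rewrite addr_ge0// Rintegral_ge0.
exists (\int[mu]_x `|g x| + K) => // b.
have gc := Rintegral_trig_bounded (mcos b) (fun x => cos_bounded _) rint_partial_mean.
have gs := Rintegral_trig_bounded (msin b) (fun x => sin_bounded _) rint_partial_mean.
have kc := Rintegral_trig_bounded (mcos b) (fun x => cos_bounded _) idxphi.
have ks := Rintegral_trig_bounded (msin b) (fun x => sin_bounded _) idxphi.
have e1 : \int[mu]_x (sin (b * x) * (phi x + x * phi1 x)) =
    - (b ^+ 2 * \int[mu]_x (sin (b * x) * g x)).
  rewrite (trig_ibp (is_derive_sin b) (@cbcos b) _ (bcos b) dxphi cdxphi ixphi idxphi hD)//.
  by rewrite trig_scale// Rintegral_cos_mean mulrA expr2.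
have e2 : \int[mu]_x (cos (b * x) * (phi x + x * phi1 x)) =
    - (b ^+ 2 * \int[mu]_x (cos (b * x) * g x)).
  rewrite (trig_ibp (is_derive_cos b) (@cbsin b) _ (bsin b) dxphi cdxphi ixphi idxphi hD)//.
  by rewrite trig_scale// Rintegral_sin_mean mulNr; ring.
rewrite e1 normrN normrM (ger0_norm (sqr_ge0 b)) in ks.
rewrite e2 normrN normrM (ger0_norm (sqr_ge0 b)) in kc.
by split; rewrite mulrDr mulr1 lerD// mulrC.
Qed.

(** [x g(x)] vanishes at infinity and has derivative [g(x) + x^2 phi(x)]. *)
Lemma Rintegral_partial_mean : \int[mu]_x g x = - \int[mu]_x (x ^+ 2 * phi x).
Proof.
have i2 : rint mu (fun x => x ^+ 2 * phi x) by exact: (rint_schwartz 2 0).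
apply/eqP; rewrite -addr_eq0 -RintegralD//; last exact: rint_partial_mean.
apply/eqP; apply: (@Rintegral_derive_eq0 _ (fun x => x * g x) _ (2 * Cg)).
- move=> x; have d := is_derive_partial_mean x.
  by apply: is_derive_eq; rewrite /GRing.scale /=; ring.
- move=> x; apply: cvgD; first exact: continuous_partial_mean.
  by apply: cvgM; [exact: exprn_continuous|exact: cphi].
- by apply: rintD => //; exact: rint_partial_mean.
- move=> x; have h := partial_mean_decay x.
  rewrite normrM (mulrC `|x| `|g x|) -mulrA.
  have w : `|x| * (1 + `|x|) <= 2 * (1 + x ^+ 2).
    rewrite -(ger0_norm (sqr_ge0 x)) normrX.
    by have := sqr_ge0 (`|x| - 1); have := normr_ge0 x; rewrite !expr2; nra.
  apply: (le_trans (ler_wpM2l _ w)) => //.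
  by rewrite mulrCA ler_wpM2l.
Qed.

End schwartz_density.

(** * Entries with a Schwartz density: moments, truncated mean, Fourier factors *)

Section schwartz_entry.
Context d (T : measurableType d) (R : realType) (P : probability T R).
Variables (X : {RV P >-> R}) (phi : R -> R).
Hypotheses (sphi : schwartz phi) (dX : has_density X phi).
Local Notation mu := (@lebesgue_measure R).

Lemma rint_power j : rint P (fun t => X t ^+ j).
Proof.
have mj : measurable_fun setT (fun t : R => t ^+ j).
  by apply: continuous_measurable_fun; exact: exprn_continuous.
by have [] := density_transfer dX mj (rint_schwartz sphi j 0).
Qed.

Lemma Rintegral_power j : \int[P]_t X t ^+ j = \int[mu]_t (t ^+ j * phi t).
Proof.
have mj : measurable_fun setT (fun t : R => t ^+ j).
  by apply: continuous_measurable_fun; exact: exprn_continuous.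
by have [] := density_transfer dX mj (rint_schwartz sphi j 0).
Qed.

Lemma rint_entry : rint P X. Proof. exact: (rint_power 1). Qed.

Lemma truncated_meanE z : truncated_mean X z = partial_mean phi z.
Proof.
have ii := rint_schwartz sphi 1 0.
pose f t : R := t * \1_(`]-oo, z]%classic) t.
have mf : measurable_fun setT f by apply: measurable_funM => //; exact: measurable_indic.
have i2 : rint mu (fun t => f t * phi t).
  rewrite (_ : EFin \o _ = EFin \o (fun t => t ^+ 1 * derive1n 0 phi t * \1_(`]-oo, z]%classic) t)).
    apply: (rintM_bounded (B := 1) ii) => [|t]; first exact: measurable_indic.
    by rewrite indicE; case: (_ \in _); rewrite ?normr1 ?normr0.
  by apply/funext => t /=; rewrite /f expr1 mulrAC.
have [_] := density_transfer dX mf i2.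
rewrite /truncated_mean unlock => e1.
transitivity (\int[P]_t f (X t)).
  apply: eq_Rintegral => t _; rewrite /f !indicE.
  suff -> : (t \in [set s | X s <= z]) = (X t \in `]-oo, z]%classic) by [].
  by apply/idP/idP => /set_mem h; apply/mem_set; move: h; rewrite /= in_itv.
rewrite e1 /partial_mean [RHS]Rintegral_mkcond; apply: eq_Rintegral => t _.
by rewrite patchE /f indicE; case: (_ \in _); rewrite ?mulr1 ?mulr0 ?mul0r.
Qed.

Let mcos := @measurable_cosM R.

Let msin := @measurable_sinM R.

Let sin_bounded := @normr_sin_le1 R.

Let cos_bounded := @normr_cos_le1 R.

Let rint_trig j (f : R -> R) : measurable_fun setT f -> (forall y, `|f y| <= 1) ->
  rint mu (fun t => t ^+ j * f t * phi t).
Proof.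
move=> mf f1; under eq_fun do rewrite mulrAC.
exact: (rintM_bounded (rint_schwartz sphi j 0) mf f1).
Qed.

Lemma fourierE (f : R -> R) w : rint mu f -> fourier f w =
  Complex (\int[mu]_t (cos (2 * pi * w * t) * f t))
    (- \int[mu]_t (sin (2 * pi * w * t) * f t)).
Proof.
move=> fi; congr Complex.
  apply: eq_Rintegral => t _; rewrite ReM /= mulr0 subr0 cosN.
  by congr (cos _ * _); ring.
rewrite -mulN1r -RintegralZl//; last first.
  under eq_fun do rewrite mulrC.
  exact: (rintM_bounded fi (msin _) (fun x => sin_bounded _)).
apply: eq_Rintegral => t _; rewrite ImM /= mulr0 add0r sinN mulNr mulN1r.
by congr (- (sin _ * _)); ring.
Qed.

Let rint_phi : rint mu phi.
Proof.
rewrite (_ : EFin \o phi = EFin \o (fun t => t ^+ 0 * derive1n 0 phi t)).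
  exact: rint_schwartz.
by apply/funext => t /=; rewrite expr0 mul1r.
Qed.

Lemma Cint_density w : Cint P (fun t => expi (- (2 * pi * w * X t))) = fourier phi w.
Proof.
set b := 2 * pi * w.
have h (f : R -> R) : measurable_fun setT f -> (forall y, `|f y| <= 1) ->
    rint mu (fun t => f t * phi t).
  by move=> mf f1; under eq_fun do rewrite mulrC; exact: (rintM_bounded rint_phi mf f1).
have [_ e1] := density_transfer dX (mcos b) (h _ (mcos b) (fun x => cos_bounded _)).
have [i2 e2] := density_transfer dX (msin b) (h _ (msin b) (fun x => sin_bounded _)).
rewrite fourierE// -/b -e1 -e2; congr Complex.
  by apply: eq_Rintegral => t _; rewrite /= cosN.
by rewrite -mulN1r -RintegralZl//; apply: eq_Rintegral => t _; rewrite /= sinN mulN1r.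
Qed.

Hypothesis mean0 : \int[mu]_t (t * phi t) = 0.

Lemma Cint_densityM w : Cint P (fun t => Complex (X t) 0 * expi (- (2 * pi * w * X t))) =
  Complex 0 (2 * pi * w) * fourier (partial_mean phi) w.
Proof.
set b := 2 * pi * w.
have mxcos : measurable_fun setT (fun y : R => y * cos (b * y)) by exact: measurable_funM.
have mxsin : measurable_fun setT (fun y : R => y * sin (b * y)) by exact: measurable_funM.
have ic : rint mu (fun y => y * cos (b * y) * phi y).
  exact: (rint_trig 1 (mcos b) (fun x => cos_bounded _)).
have isx : rint mu (fun y => y * sin (b * y) * phi y).
  exact: (rint_trig 1 (msin b) (fun x => sin_bounded _)).
have [_ e1] := density_transfer dX mxcos ic.
have [i2 e2] := density_transfer dX mxsin isx.
have c1 := Rintegral_cos_mean sphi mean0 b.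
have c2 := Rintegral_sin_mean sphi mean0 b.
have E (f : R -> R) : \int[mu]_t (t * f (b * t) * phi t) = \int[mu]_t (f (b * t) * (t * phi t)).
  by apply: eq_Rintegral => t _; ring.
rewrite (E cos) c1 in e1; rewrite (E sin) c2 in e2.
rewrite fourierE; last exact: rint_partial_mean.
rewrite -/b; apply/eqP; rewrite eq_complex ReM ImM /=; apply/andP; split; apply/eqP.
  under eq_Rintegral do rewrite mul0r subr0 cosN.
  by rewrite e1; ring.
under eq_Rintegral do rewrite mul0r addr0 sinN mulrN -mulN1r.
by rewrite RintegralZl// e2; ring.
Qed.

End schwartz_entry.

(** * Conjugation and the Fourier transform at negative frequencies *)

Section fourier_bounds.
Context {R : realType}.
Local Notation mu := (@lebesgue_measure R).

Definition cj (z : R[i]) : R[i] := Complex (complex.Re z) (- complex.Im z).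

Lemma cjM z w : cj (z * w) = cj z * cj w.
Proof.
by apply/eqP; rewrite eq_complex /cj /= !ReM !ImM /=; apply/andP; split; apply/eqP; ring.
Qed.

Lemma cj1 : cj 1 = 1. Proof. by rewrite /cj /= oppr0. Qed.

Lemma le_normc_ReIm (z : R[i]) :
  Normc.normc z <= `|complex.Re z| + `|complex.Im z|.
Proof.
case: z => a b /=; rewrite -[leRHS]ger0_norm ?addr_ge0// -sqrtr_sqr ler_wsqrtr//.
rewrite sqrrD -!normrX (ger0_norm (sqr_ge0 a)) (ger0_norm (sqr_ge0 b)).
by rewrite lerD2r lerDl mulrn_wge0// mulr_ge0.
Qed.

Lemma fourierN (f : R -> R) w : rint mu f -> fourier f (- w) = cj (fourier f w).
Proof.
move=> fi; rewrite !fourierE// /cj /=; congr Complex.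
  by apply: eq_Rintegral => t _; rewrite mulrN mulNr cosN.
rewrite opprK -mulN1r -RintegralZl//.
  apply: eq_Rintegral => t _.
  rewrite (_ : 2 * pi * - w * t = - (2 * pi * w * t)); last by ring.
  by rewrite sinN; ring.
under eq_fun do rewrite mulrC.
exact: (rintM_bounded fi (measurable_sinM _) (fun=> normr_sin_le1 _)).
Qed.

End fourier_bounds.

(** * Moments of the entries from isotropy and independence *)

Section schwartz_mean.
Context d (T : measurableType d) (R : realType) (P : probability T R).
Context (m k : nat) (e : 'I_m -> 'I_k -> {RV P >-> R}).
Hypothesis hind : mutually_independent (fun ij : 'I_m * 'I_k => e ij.1 ij.2).
Variable phi : R -> R.
Hypotheses (sphi : schwartz phi) (dens : forall i j, has_density (e i j) phi).
Hypothesis iso : forall i, isotropic P (fun t => (row i (random_matrix e t))^T).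

Let dotv_row (i : 'I_m) (z : 'cV[R]_k) t :
  dotv (row i (random_matrix e t))^T z = \sum_j e i j t * z j 0.
Proof. by apply: eq_bigr => j _; rewrite !mxE. Qed.

Let isoE (i : 'I_m) (z : 'cV[R]_k) :
  \int[P]_t (\sum_j e i j t * z j 0) ^+ 2 = \sum_j z j 0 ^+ 2.
Proof.
have := iso i z; rewrite unlock enorm_sqr => /(congr1 fine) /= <-.
by apply: eq_Rintegral => t _; rewrite dotv_row.
Qed.

Let sum_delta (f : 'I_k -> R) (j : 'I_k) :
  \sum_s f s * (delta_mx j 0 : 'cV[R]_k) s 0 = f j.
Proof.
rewrite (bigD1 j)//= mxE !eqxx mulr1 big1 ?addr0// => s sj.
by rewrite mxE (negbTE sj) mulr0.
Qed.

Lemma second_moment i j : \int[P]_t (e i j t ^+ 2) = 1.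
Proof.
have := isoE i (delta_mx j 0).
under eq_Rintegral do rewrite sum_delta; move=> ->.
under eq_bigr do rewrite expr2.
by rewrite sum_delta mxE !eqxx.
Qed.

Let iX i j : rint P (e i j). Proof. exact: rint_entry sphi (dens i j). Qed.
Let iX2 i j : rint P (fun t => e i j t ^+ 2).
Proof. exact: rint_power sphi (dens i j) 2. Qed.

Let mX i j : measurable_fun setT (e i j). Proof. exact: measurable_entry. Qed.

Let msine i j (c : R) : measurable_fun setT (fun t => sin (c * e i j t)).
Proof.
have [_ h] := cmeasurable_expi (- c).
rewrite (_ : (fun t => _) = (fun y => complex.Im (expi (- (- c * y)))) \o e i j).
  exact: measurableT_comp.
by apply/funext => t /=; rewrite mulNr opprK.
Qed.

Let iXX i a b : rint P (fun t => e i a t * e i b t).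
Proof.
apply: (rint_le _ _ (rintD (iX2 i a) (iX2 i b))) => [|t].
  exact: measurable_funM.
rewrite normrM -(ger0_norm (sqr_ge0 (e i a t))) -(ger0_norm (sqr_ge0 (e i b t))) !normrX.
have := sqr_ge0 (`|e i a t| - `|e i b t|).
have := mulr_ge0 (normr_ge0 (e i a t)) (normr_ge0 (e i b t)).
by rewrite sqrrB; lra.
Qed.

(** Isotropy at the sum of two basis vectors reads [2 = 1 + 1 + 2 E[X_a X_b]]. *)
Let uncorrelated i a b : a != b -> \int[P]_t (e i a t * e i b t) = 0.
Proof.
move=> ab; have := isoE i (delta_mx a 0 + delta_mx b 0).
have -> : \sum_j (delta_mx a 0 + delta_mx b 0 : 'cV[R]_k) j 0 ^+ 2 = 2.
  under eq_bigr do rewrite expr2 {2}mxE mulrDr.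
  rewrite big_split /= !sum_delta !mxE !eqxx (negbTE ab) eq_sym (negbTE ab) /=.
  by rewrite addr0 add0r.
under eq_Rintegral => t _.
  under eq_bigr do rewrite mxE mulrDr.
  rewrite big_split /= !sum_delta.
  rewrite (_ : _ ^+ 2 = e i a t ^+ 2 + e i b t ^+ 2 + 2 * (e i a t * e i b t)); last by ring.
  over.
rewrite RintegralD//; [|exact: rintD|exact: rintZ].
by rewrite RintegralD// RintegralZl// !second_moment; lra.
Qed.

(** [Cint_prod] admits a single unbounded factor, so the second entry enters through its sine. The
    identity is the imaginary part of the product formula for [X_a] and [e^(-i c X_b)]. *)
Let sin_mean i a b (c : R) : a != b ->
  \int[P]_t (e i a t * sin (c * e i b t)) =
  \int[P]_t e i a t * \int[P]_t sin (c * e i b t).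
Proof.
move=> ab; pose f (ij : 'I_m * 'I_k) (y : R) := expi (- (c * y)).
have f1 ij y : Normc.normc (f ij y) <= 1 by rewrite normc_expi.
have mid : cmeasurable (fun y : R => Complex y 0).
  by split; [exact: measurable_id|exact: measurable_cst].
have ir : rint P (fun t => complex.Re (Complex (e i a t) 0)) by exact: iX.
have iz : rint P (fun t => complex.Im (Complex (e i a t) 0)).
  exact: finite_measure_integrable_cst.
have ur : uniq [:: (i, a); (i, b)].
  by rewrite /= inE andbT; apply: contraNneq ab => -[->].
have [_] := @Cint_prod _ T R P _ _ hind f (fun _ => cmeasurable_expi c) f1
  (i, a) [:: (i, b)] (fun y => Complex y 0) ur mid (conj ir iz).
rewrite big_seq1 => /(congr1 (@complex.Im R)); rewrite ImM /=.
have m0 := msine i b c.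
have s1 t : `|sin (c * e i b t)| <= 1 by rewrite ler_norml sin_geN1 sin_le1.
have -> : \int[P]_t complex.Im (Complex (e i a t) 0 * \prod_(s <- [:: (i, b)]) f s (e s.1 s.2 t)) =
    - \int[P]_t (e i a t * sin (c * e i b t)).
  rewrite -mulN1r -RintegralZl//; last exact: rintM_bounded (iX i a) m0 s1.
  apply: eq_Rintegral => t _; rewrite big_seq1 ImM /= sinN; ring.
have -> : \int[P]_t sin (- (c * e i b t)) = - \int[P]_t sin (c * e i b t).
  rewrite -mulN1r -RintegralZl//; last exact: rint_bounded m0 s1.
  by apply: eq_Rintegral => t _; rewrite sinN mulN1r.
by rewrite Rintegral_prob_cst mul0r addr0 mulrN => /oppr_inj.
Qed.

Let le_sin (y : R) : `|sin y| <= `|y|.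
Proof.
have key (z : R) : 0 <= z -> `|sin z| <= z.
  move=> z0; have [|c _] := @MVT_segment R sin cos 0 z z0.
    by apply: continuous_subspaceT; exact: continuous_sin.
  rewrite sin0 !subr0 => ->; rewrite normrM (ger0_norm z0) ler_piMl//.
  by rewrite ler_norml cos_geN1 cos_le1.
have [y0|y0] := leP 0 y; first by rewrite (ger0_norm y0) key.
by have := key (- y); rewrite sinN normrN oppr_ge0 (ltr0_norm y0); apply; exact: ltW.
Qed.

Let cvg_sin_scaled (y : R) : n.+1%:R * sin (n.+1%:R^-1 * y) @[n --> \oo] --> y.
Proof.
have ds : is_derive (0 : R) 1 (fun h : R => sin (h * y)) y.
  by apply: is_derive_eq; rewrite /GRing.scale /= mul0r cos0; ring.
have h1 : h^-1 *: (sin (h * y)) @[h --> 0^'] --> y.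
  have /cvg_ex[l hl] : derivable (fun h : R => sin (h * y)) 0 1 by exact: ex_derive.
  have ly : l = y.
    by rewrite -(@derive_val _ _ _ _ _ _ _ ds); apply/esym/cvg_lim.
  rewrite ly in hl; move: hl; apply: cvg_trans; apply: near_eq_cvg.
  by apply: nearW => h; rewrite /= mul0r sin0 subr0 addr0 [_ *: 1]mulr1.
have /cvgr_dnbhsP/(_ (fun n => n.+1%:R^-1)) h2 := h1.
rewrite (_ : (fun n => _) = (fun n => (n.+1%:R^-1)^-1 *: sin (n.+1%:R^-1 * y))).
  by apply: h2; split; [move=> n; rewrite invr_eq0 pnatr_eq0|exact: cvg_harmonic].
by apply/funext => n; rewrite invrK.
Qed.

(* The product rule for [Xa] and the bounded variables [sin (c Xb)], divided by
   [c], tends to the product rule for [Xa] and [Xb]. *)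
Lemma mean_zero (i : 'I_m) (a b : 'I_k) : a != b -> \int[lebesgue_measure]_t (t * phi t) = 0.
Proof.
move=> ab.
have mu1 j : \int[P]_t e i j t = \int[lebesgue_measure]_t (t * phi t).
  exact: (Rintegral_power sphi (dens i j) 1).
have ms n := msine i b n.+1%:R^-1.
have msin n : measurable_fun setT (fun t => n.+1%:R * sin (n.+1%:R^-1 * e i b t)).
  exact: measurable_funM.
have bd n t : `|n.+1%:R * sin (n.+1%:R^-1 * e i b t)| <= `|e i b t|.
  rewrite normrM (le_trans (ler_wpM2l _ (le_sin _)))// normrM mulrA.
  by rewrite -[X in X * _]normrM divff ?normr1 ?mul1r// pnatr_eq0.
have isn n : rint P (fun t => n.+1%:R * sin (n.+1%:R^-1 * e i b t)).
  by apply: rint_le (bd n) _ => //; exact: integrable_norm.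
have h1 : \int[P]_t (e i a t * (n.+1%:R * sin (n.+1%:R^-1 * e i b t))) @[n --> \oo]
    --> \int[P]_t (e i a t * e i b t).
  apply: (@Rintegral_dominated _ _ _ _ _ _ (fun t => `|e i a t * e i b t|)).
  - by move=> n; exact: measurable_funM.
  - exact: measurable_funM.
  - by move=> t; apply: cvgM; [exact: cvg_cst|exact: cvg_sin_scaled].
  - exact: integrable_norm (iXX i a b).
  - by move=> n t; rewrite !(normrM (e i a t)) ler_wpM2l.
have h2 : \int[P]_t e i a t * \int[P]_t (n.+1%:R * sin (n.+1%:R^-1 * e i b t))
    @[n --> \oo] --> \int[P]_t e i a t * \int[P]_t e i b t.
  apply: cvgM; first exact: cvg_cst.
  apply: (@Rintegral_dominated _ _ _ _ _ _ (fun t => `|e i b t|)) => //.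
  exact: integrable_norm.
have s1 n t : `|sin (n.+1%:R^-1 * e i b t)| <= 1 by rewrite ler_norml sin_geN1 sin_le1.
have E n : \int[P]_t (e i a t * (n.+1%:R * sin (n.+1%:R^-1 * e i b t))) =
    \int[P]_t e i a t * \int[P]_t (n.+1%:R * sin (n.+1%:R^-1 * e i b t)).
  rewrite RintegralZl//; last exact: rint_bounded (ms n) (s1 n).
  rewrite mulrCA -sin_mean// -RintegralZl//; last exact: rintM_bounded (iX i a) (ms n) (s1 n).
  by apply: eq_Rintegral => t _; ring.
rewrite (_ : (fun n => _) = (fun n => \int[P]_t e i a t * \int[P]_t (n.+1%:R * sin (n.+1%:R^-1 * e i b t)))) in h1.
  have h0 : \int[P]_t (e i a t * e i b t) = \int[P]_t e i a t * \int[P]_t e i b t.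
    exact: (cvg_unique _ h1 h2).
  move: h0; rewrite uncorrelated// !mu1 => /esym/eqP.
  by rewrite mulf_eq0 => /orP[] /eqP.
by apply/funext => n; exact: E.
Qed.

End schwartz_mean.

(** * Bilateral series of complex numbers *)

Lemma sum_symmetric (V : zmodType) (F : int -> V) N :
  \sum_(j < N.*2.+1) F (j%:Z - N%:Z) =
  F 0 + \sum_(n < N) (F n.+1%:Z + F (- n.+1%:Z)).
Proof.
elim: N => [|N IH]; first by rewrite big_ord_recl !big_ord0 subrr.
rewrite doubleS big_ord_recl big_ord_recr /= [in RHS]big_ord_recr /=.
rewrite [in RHS]addrA -IH.
have -> : \sum_(i < N.*2.+1) F ((bump 0 i)%:Z - N.+1%:Z) =
    \sum_(i < N.*2.+1) F (i%:Z - N%:Z).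
  by apply: eq_bigr => i _; congr F; rewrite /bump /=; lia.
rewrite (_ : 0%:Z - N.+1%:Z = - N.+1%:Z); last by lia.
rewrite (_ : _ - N.+1%:Z = N.+1%:Z); last by rewrite /bump /=; lia.
by rewrite addrCA (addrC (F (- N.+1%:Z))).
Qed.

Section complex_series.
Context {R : realType}.

Lemma limn_Complex (u : nat -> R) (l : R) : u n @[n --> \oo] --> l ->
  limn (fun n => (Complex (u n) 0 : R[i]^o)) = Complex l 0.
Proof.
move=> ul; apply/cvg_lim => //; apply/cvgrPdist_lt => eps.
rewrite ltcE /= => /andP[/eqP e0 ep].
have /cvgrPdist_lt /(_ _ ep) := ul; apply: filterS => n un.
rewrite normc_def ltcE /= e0 eqxx /= subrr expr0n addr0 sqrtr_sqr.
exact: un.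
Qed.

Lemma sumZ_real (F : int -> R[i]) (u : nat -> R) (f0 l : R) :
  F 0 = Complex f0 0 ->
  (forall n : nat, F n.+1%:Z + F (- n.+1%:Z) = Complex (u n) 0) ->
  f0 + \sum_(n < N) u n @[N --> \oo] --> l -> sumZ F = Complex l 0.
Proof.
move=> F0 Fn ul; rewrite /sumZ.
rewrite (_ : (fun N : nat => _) =
  (fun N => (Complex (f0 + \sum_(n < N) u n) 0 : R[i]^o))); first exact: limn_Complex.
apply/funext => N; rewrite sum_symmetric F0.
under eq_bigr do rewrite Fn.
elim: N => [|N IH]; first by rewrite !big_ord0 !addr0.
by rewrite !big_ord_recr /= !addrA IH; apply/eqP; rewrite eq_complex /= !addr0 !eqxx.
Qed.

Let nneseries_decay (a : nat -> R) (C : R) : (forall n, 0 <= a n) ->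
  (forall n, a n * (1 + n%:R ^+ 2) <= C) -> (\sum_(n <oo) (a n)%:E < +oo)%E.
Proof.
move=> a0 aC.
have C0 : 0 <= C by apply: le_trans (aC 0%N); rewrite mulr_ge0// addr_ge0// sqr_ge0.
(* Telescoping majorant with decrements [6 C / ((n+1) (n+2))]; the 6 works because
   [(n+1) (n+2) <= 6 (1 + n^2)]. *)
have step n : a n <= 6 * C / n.+1%:R - 6 * C / n.+2%:R.
  have h := aC n; rewrite -[n.+2]addn1 natrD -[n.+1]addn1 natrD.
  have : 0 <= n%:R :> R by [].
  move: h; set y := n%:R => h y0.
  have y2 : 0 < 1 + y ^+ 2 by rewrite ltr_pwDl// sqr_ge0.
  rewrite -ler_pdivlMr// in h; apply: le_trans h _.
  rewrite -subr_ge0 (_ : _ - _ = C * (5 * y ^+ 2 - 3 * y + 4) /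
      ((1 + y ^+ 2) * (y + 1) * (y + 2))); last first.
    by field; rewrite !gt_eqF//; lra.
  have y3 : 0 <= 5 * y ^+ 2 - 3 * y + 4.
    by have := sqr_ge0 (y - 1); have := sqr_ge0 y; lra.
  apply: divr_ge0; first exact: mulr_ge0.
  by apply: mulr_ge0; [apply: mulr_ge0; [exact: ltW|lra]|lra].
have psum n : \sum_(0 <= k < n) a k <= 6 * C - 6 * C / n.+1%:R.
  elim: n => [|n IH]; first by rewrite big_nil divr1 subrr.
  by rewrite big_nat_recr//= (le_trans (lerD IH (step n)))// addrA subrK.
apply: (@le_lt_trans _ _ (6 * C)%:E); last exact: ltry.
apply: lime_le; first by apply: is_cvg_nneseries => n _ _; rewrite lee_fin.
apply: nearW => n; rewrite sumEFin lee_fin; apply: le_trans (psum n) _.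
by rewrite lerBlDr lerDl divr_ge0// mulr_ge0.
Qed.

(** The integers split into [Posz] and [Negz], each indexed by the naturals. Since [Negz n] is
    [-(n+1)], the weight available there exceeds the one required at [n]. *)
Lemma Csummable_decay (F : int -> R[i]) (C : R) :
  (forall p : int, Normc.normc (F p) * (1 + p%:~R ^+ 2) <= C) -> Csummable F.
Proof.
move=> FC; rewrite /Csummable /summable.
have n0 p : (0 <= `|(Normc.normc (F p))%:E|)%E by [].
rewrite (esumID [set p : int | 0 <= p])//.
apply: lte_add_pinfty.
  rewrite (@reindex_esum R _ _ setT _ Posz); last first.
    split=> [n _ //|? ? _ _ []//|[n|n] [_ //= _]]; first by exists n.
  rewrite -nneseries_esumT//.
  under eq_eseriesr do rewrite gee0_abs ?lee_fin ?normc_ge0//.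
  apply: (@nneseries_decay _ C) => n; first exact: normc_ge0.
  exact: (FC n).
rewrite (@reindex_esum R _ _ setT _ Negz); last first.
  split=> [n _ //|? ? _ _ []//|[n|n] [_ h]]; last by exists n.
  by exfalso; apply: h.
rewrite -nneseries_esumT//.
under eq_eseriesr do rewrite gee0_abs ?lee_fin ?normc_ge0//.
apply: (@nneseries_decay _ C) => n; first exact: normc_ge0.
apply: le_trans (FC (Negz n)); rewrite ler_wpM2l ?normc_ge0// lerD2l.
rewrite NegzE intrN sqrrN ler_sqr ?nnegrE//.
by rewrite ler_nat.
Qed.

Lemma normc_prod (I : Type) (r : seq I) (Q : pred I) (f : I -> R[i]) :
  Normc.normc (\prod_(i <- r | Q i) f i) = \prod_(i <- r | Q i) Normc.normc (f i).
Proof.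
apply: (big_morph (fun z : R[i] => Normc.normc z)); first exact: normcM.
by rewrite /= expr0n addr0 expr1n sqrtr1.
Qed.

Lemma cj_prod (I : Type) (r : seq I) (Q : pred I) (f : I -> R[i]) :
  cj (\prod_(i <- r | Q i) f i) = \prod_(i <- r | Q i) cj (f i).
Proof. exact: (big_morph cj cjM cj1). Qed.

Lemma exprz_signN (n : nat) : (-1 : R[i]) ^ (- n%:Z) = (-1) ^+ n.
Proof.
case: n => [|n]; first by rewrite oppr0.
by rewrite -NegzE /exprz -exprVn invrN invr1.
Qed.

Lemma sign_Complex (n : nat) : (-1 : R[i]) ^+ n = Complex ((-1) ^+ n) 0.
Proof.
elim: n => [//|n IH]; rewrite !exprS IH.
by apply/eqP; rewrite eq_complex ReM ImM /=; apply/andP; split; apply/eqP; ring.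
Qed.

End complex_series.

Lemma Rintegral_prob_le1 d (T : measurableType d) (R : realType)
    (P : probability T R) (f : T -> R) : measurable_fun setT f ->
  (forall t, `|f t| <= 1) -> `|\int[P]_t f t| <= 1.
Proof.
move=> mf f1; have fi := rint_bounded P mf f1.
rewrite (le_trans (le_normr_Rintegral measurableT fi))//.
rewrite -[leRHS](Rintegral_prob_cst P); apply: le_Rintegral => //.
  exact: integrable_norm fi.
exact: finite_measure_integrable_cst.
Qed.

(** * Matrices with a Schwartz density: the bilateral series *)

Section schwartz_matrix.
Context d (T : measurableType d) (R : realType) (P : probability T R).
Context (m k : nat) (e : 'I_m -> 'I_k -> {RV P >-> R}).
Hypothesis hind : mutually_independent (fun ij : 'I_m * 'I_k => e ij.1 ij.2).
Variables (delta : R) (x : 'cV[R]_k) (phi : R -> R).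
Hypotheses (delta_gt0 : 0 < delta) (hm : exists l : 'I_m, True).
Hypotheses (sphi : schwartz phi) (dens : forall i j, has_density (e i j) phi).
Local Notation mu := (@lebesgue_measure R).
Hypotheses (mean0 : \int[mu]_t (t * phi t) = 0)
  (var1 : \int[mu]_t (t ^+ 2 * phi t) = 1).

Let g := partial_mean phi.

(** The summand of the series without its alternating sign, absolute value and signs of [x_i], as a
    function of a real frequency. The coefficient [E[X e^(-i n theta)]] of a row is [i kappa n]
    times its value at [n]. *)
Definition row_factor (i : 'I_k) (tau : R) : R[i] :=
  fourier g (x i 0 / delta * tau) *
  \prod_(s < k | s != i) fourier phi (x s 0 / delta * tau).
Local Notation H := row_factor.

Let kappa i := 2 * pi * x i 0 / delta.

Let ig : rint mu g. Proof. exact: rint_partial_mean. Qed.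

Let iphi : rint mu phi.
Proof.
rewrite (_ : EFin \o phi = EFin \o (fun t => t ^+ 0 * derive1n 0 phi t)).
  exact: rint_schwartz.
by apply/funext => t /=; rewrite expr0 mul1r.
Qed.

Let coefs l i n :
  cos_coef P (e l i) (measurement e x l) delta n = - (kappa i * n%:R) * complex.Im (H i n%:R) /\
  sin_coef P (e l i) (measurement e x l) delta n = - (kappa i * n%:R) * complex.Re (H i n%:R).
Proof.
have := row_coef hind delta x n (rint_entry sphi (dens l i)).
have wE s : 2 * pi * n%:R * x s 0 / delta = 2 * pi * (x s 0 / delta * n%:R) by ring.
rewrite wE; under eq_bigr do rewrite wE (Cint_density sphi (dens l _)).
rewrite (Cint_densityM sphi (dens l i) mean0) -mulrA -/(H i n%:R) => E.
have E1 := congr1 (@complex.Re R) E; have E2 := congr1 (@complex.Im R) E.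
rewrite ReM /= in E1; rewrite ImM /= in E2.
split; first by rewrite E1 /kappa; ring.
by apply: oppr_inj; rewrite E2 /kappa; ring.
Qed.

Let fourier_phi_le (i : 'I_k) w : Normc.normc (fourier phi w) <= 2.
Proof.
have [l _] := hm; rewrite -(Cint_density sphi (dens l i)).
apply: (le_trans (le_normc_ReIm _)); rewrite -[leRHS]/(1 + 1) /=.
have [m1 m2] := cmeasurable_expi (2 * pi * w).
have mX : measurable_fun setT (e l i) by exact: measurable_entry.
apply: lerD; apply: Rintegral_prob_le1 => [|t].
- exact: (measurableT_comp m1 mX).
- by rewrite ler_norml cos_geN1 cos_le1.
- exact: (measurableT_comp m2 mX).
- by rewrite ler_norml sin_geN1 sin_le1.
Qed.

(** Only the transform of [g] decays; the other factors are merely bounded. Its decay in [kappa tau]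
    is decay in [tau] because [kappa != 0], through [1 + tau^2 <= (1 + kappa^-2) (1 + (kappa
    tau)^2)]. *)
Let H_decay i : x i 0 != 0 ->
  exists C, forall tau, Normc.normc (H i tau) * (1 + tau ^+ 2) <= C.
Proof.
move=> xi; have [C C0 hC] := Rintegral_trig_decay sphi mean0.
have kN0 : kappa i != 0.
  by rewrite /kappa !mulf_neq0 ?invr_eq0 ?(gt_eqF delta_gt0)// gt_eqF// pi_gt0.
pose D : R := \prod_(s < k | s != i) 2.
have D0 : 0 <= D by apply: prodr_ge0.
exists ((1 + (kappa i)^-2) * (2 * C * D)) => tau.
have PD : \prod_(s < k | s != i) Normc.normc (fourier phi (x s 0 / delta * tau)) <= D.
  by apply: ler_prod => s _; rewrite normc_ge0 (fourier_phi_le i).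
have gC : Normc.normc (fourier g (x i 0 / delta * tau)) * (1 + (kappa i * tau) ^+ 2) <= 2 * C.
  have [h1 h2] := hC (kappa i * tau).
  have z0 : 0 <= 1 + (kappa i * tau) ^+ 2 by rewrite addr_ge0// sqr_ge0.
  apply: le_trans (ler_wpM2r z0 (le_normc_ReIm _)) _.
  rewrite fourierE// /= normrN mulrDl.
  have -> : 2 * pi * (x i 0 / delta * tau) = kappa i * tau by rewrite /kappa; ring.
  by rewrite mulrDl mul1r; apply: lerD.
rewrite normcM normc_prod.
have wt : 1 + tau ^+ 2 <= (1 + (kappa i)^-2) * (1 + (kappa i * tau) ^+ 2).
  have -> : (1 + (kappa i)^-2) * (1 + (kappa i * tau) ^+ 2) =
      1 + tau ^+ 2 + ((kappa i)^-1 ^+ 2 + (kappa i * tau) ^+ 2).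
    by rewrite exprVn; field.
  by rewrite lerDl addr_ge0// sqr_ge0.
set Pr := \prod_(_ < _ | _) _ in PD *; set G := Normc.normc _ in gC *.
have Pr0 : 0 <= Pr by apply: prodr_ge0 => s _; exact: normc_ge0.
have G0 : 0 <= G by exact: normc_ge0.
apply: le_trans (ler_wpM2l (mulr_ge0 G0 Pr0) wt) _.
rewrite mulrCA ler_wpM2l//; first by rewrite addr_ge0// invr_ge0 sqr_ge0.
by rewrite mulrAC; apply: ler_pM => //; rewrite mulr_ge0// addr_ge0// sqr_ge0.
Qed.

Let HN i tau : H i (- tau) = cj (H i tau).
Proof.
rewrite /H cjM cj_prod mulrN fourierN//; congr (_ * _).
by apply: eq_bigr => s _; rewrite mulrN fourierN.
Qed.

Let H0 i : H i 0 = -1.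
Proof.
have [l _] := hm.
have phi1 : \int[mu]_t phi t = 1.
  rewrite -(Rintegral_prob_cst P 1); transitivity (\int[mu]_t (t ^+ 0 * phi t)).
    by apply: eq_Rintegral => t _; rewrite expr0 mul1r.
  rewrite -(Rintegral_power sphi (dens l i) 0).
  by apply: eq_Rintegral => t _; rewrite expr0.
rewrite /H mulr0 big1 => [|s _]; last first.
  rewrite mulr0 fourierE// mulr0.
  under eq_Rintegral do rewrite mul0r cos0 mul1r.
  under [X in Complex _ (- X)]eq_Rintegral do rewrite mul0r sin0 mul0r.
  by rewrite phi1 /Rintegral integral0 oppr0.
rewrite mulr1 fourierE// mulr0.
under eq_Rintegral do rewrite mul0r cos0 mul1r.
under [X in Complex _ (- X)]eq_Rintegral do rewrite mul0r sin0 mul0r.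
rewrite (Rintegral_partial_mean sphi mean0) var1.
rewrite (_ : \int[mu]__ 0 = 0) ?oppr0; last by rewrite /Rintegral integral0.
by apply/eqP; rewrite eq_complex /= oppr0 !eqxx.
Qed.

Definition spectrum (i : 'I_k) (p : int) : R[i] :=
  (-1) ^ p * fourier g (`|x i 0| / delta * p%:~R) *
    \prod_(s < k | s != i) fourier phi (x s 0 * Num.sg (x i 0) / delta * p%:~R).
Local Notation F := spectrum.

(** As [|x_i|] is [x_i] times its sign, the absolute value and all signs in the summand amount to a
    sign on the frequency. *)
Let FE i p : F i p = (-1) ^ p * H i (Num.sg (x i 0) * p%:~R).
Proof.
rewrite /F /H -mulrA; congr (_ * (fourier g _ * _)).
  by rewrite normrEsg; ring.
by apply: eq_bigr => s _; congr (fourier phi _); ring.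
Qed.

Let normc_sign (p : int) : Normc.normc ((-1 : R[i]) ^ p) = 1.
Proof.
have key n : Normc.normc ((-1 : R[i]) ^+ n) = 1.
  by rewrite sign_Complex normc_real normrX normrN1 expr1n.
by case: p => n; [exact: key|rewrite NegzE exprz_signN key].
Qed.

Lemma spectrum_summable i : x i 0 != 0 -> Csummable (F i).
Proof.
move=> xi; have [C hC] := H_decay xi.
apply: (@Csummable_decay _ _ C) => p; rewrite FE normcM normc_sign mul1r.
apply: le_trans (hC (Num.sg (x i 0) * p%:~R)).
by rewrite exprMn sqr_sg xi mul1r.
Qed.

Let F0 i : F i 0 = Complex (-1) 0.
Proof.
rewrite FE mulr0 H0 expr0z mul1r.
by apply/eqP; rewrite eq_complex /= oppr0 !eqxx.
Qed.

(** Opposite frequencies give conjugate values, whose sum is twice the real part; that real part is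
    even in the frequency, so the sign of [x_i] drops out. *)
Let F_pair i (n : nat) : x i 0 != 0 -> F i n.+1%:Z + F i (- n.+1%:Z) =
  Complex (2 * ((-1) ^+ n.+1 * complex.Re (H i n.+1%:R))) 0.
Proof.
move=> xi; rewrite !FE exprz_signN intrN mulrN HN.
rewrite -[(-1) ^ n.+1%:Z]/((-1) ^+ n.+1) sign_Complex.
have -> : complex.Re (H i n.+1%:R) = complex.Re (H i (Num.sg (x i 0) * n.+1%:Z%:~R)).
  have [h|h|h] := ltrgt0P (x i 0).
  - by rewrite gtr0_sg// mul1r.
  - by rewrite ltr0_sg// mulN1r HN.
  - by rewrite h eqxx in xi.
set z := H i _; set s := (-1) ^+ _ : R.
apply/eqP; rewrite eq_complex [complex.Re (_ + _)]raddfD [complex.Im (_ + _)]raddfD /=.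
by rewrite !ReM !ImM /=; apply/andP; split; apply/eqP; ring.
Qed.

Let S i N : R := -1 + \sum_(n < N) 2 * ((-1) ^+ n.+1 * complex.Re (H i n.+1%:R)).

Let error_limit l i :
  rint P (fun t => e l i t * (measurement e x l t - quant delta (measurement e x l t))) /\
  x i 0 + x i 0 * S i N @[N --> \oo] -->
  \int[P]_t (e l i t * (measurement e x l t - quant delta (measurement e x l t))).
Proof.
have pN0 : pi != 0 :> R by rewrite gt_eqF// pi_gt0.
(* With the factor [kappa] included the bound also covers [x_i = 0], where [H_decay] does not
   apply. *)
have [C hC] : exists C, forall tau : R, `|kappa i| * Normc.normc (H i tau) * (1 + tau ^+ 2) <= C.
  have [x0|xi] := eqVneq (x i 0) 0.
    by exists 0 => tau; rewrite /kappa x0 mulr0 mul0r normr0 !mul0r.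
  by have [C hC] := H_decay xi; exists (`|kappa i| * C) => tau; rewrite -mulrA ler_wpM2l.
have term n : sin_coef P (e l i) (measurement e x l) delta n.+1 / n.+1%:R =
    - (kappa i * complex.Re (H i n.+1%:R)).
  rewrite (coefs l i n.+1).2.
  by field; rewrite ?nat1r ?natr1 pnatr_eq0.
have [||h1 h2] := @quant_error_series _ T R P (e l i) (measurement e x l) delta
  C (rint_entry sphi (dens l i)) (measurable_measurement e x l) delta_gt0.
- move=> n; rewrite term normrN normrM ler_pdivlMr ?exprn_gt0//.
  apply: le_trans (hC n.+1%:R).
  apply: ler_pM; rewrite ?mulr_ge0 ?sqr_ge0//; last by rewrite lerDr.
  by rewrite ler_wpM2l// ge_Re_normc.
- apply/norm_cvg0P.
  (* The factor [n] of the cosine coefficient costs one power of the decay; what remains is of order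
     [1/n], by [n (n+1) <= 2 (1 + n^2)]. *)
  apply: (@squeeze_cvgr _ _ _ _ (cst 0) (fun n => (2 * C) * n.+1%:R^-1)).
  + apply: nearW => n /=; rewrite normr_ge0 /= ler_pdivlMr//.
    rewrite (coefs l i n).1 normrM normrN normrM [X in _ * X * _]ger0_norm//.
    have h := hC n%:R.
    have I0 : `|kappa i| * `|complex.Im (H i n%:R)| <= `|kappa i| * Normc.normc (H i n%:R).
      by rewrite ler_wpM2l// ge_Im_normc.
    have n0 : 0 <= n%:R * n.+1%:R :> R by rewrite mulr_ge0.
    have w : n%:R * n.+1%:R <= 2 * (1 + n%:R ^+ 2) :> R.
      rewrite -[n.+1]addn1 natrD; have := sqr_ge0 (n%:R - 1 : R).
      by rewrite !expr2; nra.
    rewrite (_ : _ * _ * _ * _ = `|kappa i| * `|complex.Im (H i n%:R)| * (n%:R * n.+1%:R)); last by ring.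
    apply: le_trans (ler_wpM2r n0 I0) _.
    have K0 : 0 <= `|kappa i| * Normc.normc (H i n%:R) by rewrite mulr_ge0// normc_ge0.
    by apply: le_trans (ler_wpM2l K0 w) _; rewrite mulrCA ler_wpM2l.
  + exact: cvg_cst.
  + by rewrite -[X in _ --> X](mulr0 (2 * C)); apply: cvgMr; exact: cvg_harmonic.
split=> //; rewrite (_ : (fun N => x i 0 + x i 0 * S i N) = (fun N => delta / pi *
    \sum_(n < N) (-1) ^+ n *
      (sin_coef P (e l i) (measurement e x l) delta n.+1 / n.+1%:R)))//.
apply/funext => N; rewrite /S mulrDr mulrN1 addrA subrr add0r !mulr_sumr.
apply: eq_bigr => n _; rewrite term /kappa exprS; move: pN0.
generalize (pi : R) => p p0; field; rewrite p0 /=.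
by rewrite gt_eqF.
Qed.

Lemma schwartz_matrix_integrable :
  integrable_vec P (fun t => residual delta x (random_matrix e t)).
Proof. by apply: integrable_residual => l i; have [] := error_limit l i. Qed.

Lemma schwartz_expectation i :
  Complex (expectation_vec P (fun t => residual delta x (random_matrix e t)) i 0) 0 =
  m%:R * (Complex (x i 0) 0 + Complex (x i 0) 0 * sumZ (F i)).
Proof.
have [l0 _] := hm.
pose v j := \int[P]_t (e l0 j t * (measurement e x l0 t - quant delta (measurement e x l0 t))).
rewrite (@expectation_residual _ _ _ _ _ _ e delta x v).
- have mC n : n%:R = Complex (n%:R : R) 0 :> R[i].
    elim: n => [//|n IH]; rewrite -[n.+1]addn1 !natrD IH.
    by apply/eqP; rewrite eq_complex /= addr0 !eqxx.
  suff -> : Complex (x i 0) 0 + Complex (x i 0) 0 * sumZ (F i) = Complex (v i) 0.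
    rewrite mC; apply/eqP; rewrite eq_complex ReM ImM /=.
    by apply/andP; split; apply/eqP; ring.
  have [_ h] := error_limit l0 i; rewrite -/(v i) in h.
  (* For [x_i = 0] every frequency is 0 and the terms are [-(-1)^p]: the symmetric partial sums
     oscillate, and the value of [sumZ] matters only through its product with 0. *)
  have [x0|xi] := eqVneq (x i 0) 0.
    have E0 : (fun N => x i 0 + x i 0 * S i N) = cst 0.
      by apply/funext => N; rewrite x0 mul0r addr0.
    rewrite E0 in h.
    have h0 : cst (0 : R) n @[n --> \oo] --> (0 : R) by exact: cvg_cst.
    have v0 : v i = 0 by exact: (cvg_unique _ h h0).
    by rewrite v0 x0 mul0r addr0.
  have hS : S i N @[N --> \oo] --> (x i 0)^-1 * v i - 1.
    rewrite (_ : S i = (fun N => (x i 0)^-1 * (x i 0 + x i 0 * S i N) - 1)).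
      by apply: cvgB; [apply: cvgM; [exact: cvg_cst|exact: h]|exact: cvg_cst].
    by apply/funext => N; field.
  rewrite (sumZ_real (F0 i) (fun n => F_pair n xi) hS).
  apply/eqP; rewrite eq_complex [complex.Re (_ + _)]raddfD [complex.Im (_ + _)]raddfD /=.
  by apply/andP; split; apply/eqP; field.
- by move=> l j; have [] := error_limit l j.
(* The approximating sequence [x_j + x_j S j N] does not mention the row, so every row has the limit
   found in row [l0]. *)
- move=> l j; have [_ h] := error_limit l j; have [_ h'] := error_limit l0 j.
  exact: (cvg_unique _ h h').
Qed.

End schwartz_matrix.

Theorem theorem3p6 (R : realType) (d : measure_display) (T : measurableType d)
    (P : probability T R) (m k : nat) (hk : (0 < k)%N) (hkm : (k < m)%N)
    (delta : R) (hdelta : 0 < delta) (x : 'cV[R]_k)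
    (e : 'I_m -> 'I_k -> {RV P >-> R})
    (hind : mutually_independent (fun ij : 'I_m * 'I_k => e ij.1 ij.2)) :
  let E : T -> 'M[R]_(m, k) := random_matrix e in
  let V : T -> 'cV[R]_k := fun t => residual delta x (E t) in
  let EV : 'cV[R]_k := expectation_vec P V in
  (forall phi : R -> R,
    (forall i, subgaussian_vec P (fun t => (row i (E t))^T)) ->
    (forall i, isotropic P (fun t => (row i (E t))^T)) ->
    schwartz phi ->
    (forall i j, has_density (e i j) phi) ->
    (* For k >= 2 the entries are centered by isotropy and independence; for
       k = 1 centering must be assumed, otherwise g is not integrable and its
       Fourier transform is undefined. *)
    (k = 1%N -> forall i j, ('E_P[e i j] = 0)%E) ->
    let g : R -> R :=
      truncated_mean (e (Ordinal (ltn_trans hk hkm)) (Ordinal hk)) in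
    let F : 'I_k -> int -> R[i] := fun i p =>
      (-1) ^ p * fourier g (`|x i 0| / delta * p%:~R) *
      \prod_(s < k | s != i)
        fourier phi (x s 0 * Num.sg (x i 0) / delta * p%:~R) in
    [/\ integrable_vec P V,
        forall z : R, g z = \int[lebesgue_measure]_(t in `]-oo, z]) (t * phi t),
        forall i, x i 0 != 0 -> Csummable (F i) &
        forall i, ((EV i 0)%:C)%C =
          m%:R * (((x i 0)%:C)%C + ((x i 0)%:C)%C * sumZ (F i))]) /\
  ((forall i j, standard_gaussian (e i j)) ->
    let a : nat -> R := fun p =>
      (-1) ^+ p *
      expR (- (2 * pi ^+ 2 * enorm x ^+ 2 * p%:R ^+ 2 / delta ^+ 2)) in
    let mu : R := m%:R^-1 * enorm EV in
    [/\ integrable_vec P V,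
        x != 0 -> cvgn (fun n => \sum_(1 <= p < n) a p),
        forall i, EV i 0 = - 2 * m%:R * x i 0 * limn (fun n => \sum_(1 <= p < n) a p) &
        (* all three members vanish when x = 0 *)
        x != 0 ->
        2 * enorm x *
          (expR (- (2 * pi ^+ 2 * enorm x ^+ 2 / delta ^+ 2)) -
           expR (- (8 * pi ^+ 2 * enorm x ^+ 2 / delta ^+ 2))) < mu /\
        mu < 2 * enorm x *
          expR (- (2 * pi ^+ 2 * enorm x ^+ 2 / delta ^+ 2))]).
Proof.
move=> E V EV.
have hm : exists l : 'I_m, True by exists (Ordinal (ltn_trans hk hkm)).
split.
- move=> phi _ iso sphi dens k1 g F.
  pose i0 : 'I_m := Ordinal (ltn_trans hk hkm); pose j0 : 'I_k := Ordinal hk.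
  (* All entries share the density [phi], so centering one entry centers them all. For [k >= 2] the
     columns 0 and 1 of a single row are enough. *)
  have mean0 : \int[lebesgue_measure]_t (t * phi t) = 0.
    have [k1'|kn1] := eqVneq k 1%N.
      have := k1 k1' i0 j0; rewrite unlock => /(congr1 fine) /= <-.
      by rewrite -(Rintegral_power sphi (dens i0 j0) 1).
    have k2 : (1 < k)%N by rewrite ltn_neqAle eq_sym kn1.
    by apply: (mean_zero hind sphi dens iso i0 (a := j0) (b := Ordinal k2)).
  have var1 : \int[lebesgue_measure]_t (t ^+ 2 * phi t) = 1.
    by rewrite -(Rintegral_power sphi (dens i0 j0) 2) second_moment.
  have gE : g = partial_mean phi.
    by apply/funext => z; exact: truncated_meanE.
  have FE i : F i = spectrum delta x phi i.
    by apply/funext => p; rewrite /F gE.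
  split.
  + exact: (schwartz_matrix_integrable hind x hdelta hm sphi dens mean0).
  + by move=> z; rewrite gE.
  + by move=> i xi; rewrite FE; exact: (spectrum_summable hdelta hm sphi dens mean0).
  + move=> i; rewrite FE.
    exact: (schwartz_expectation hind x hdelta hm sphi dens mean0 var1).
- move=> he a mu; split.
  + exact: (gaussian_matrix_integrable hind x hdelta he).
  + move=> x0; exact: (gaussian_series_cvg hind hdelta he hm x0).
  + by move=> i; exact: (gaussian_expectation hind x hdelta he hm).
  + by move=> x0; exact: (gaussian_mu_bounds hind hdelta he hm x0).
Qed.
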